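(* Let $\nu$ be a probability measure on $[-\pi,\pi]$ which is absolutely continuous with respect to Lebesgue measure, with probability density $p$ such that $p\in\mathcal{L}\cap\mathcal{A}$. Then for every $n\ge 1$ and every partition $\rho$ of $\{1,\dots,n\}$ the expansion coefficient $K_{\rho,\nu}$ exists. Moreover, if $\rho$ has $r$ blocks, then $$K_{\rho,\nu}=K_{\rho,u}\cdot(2\pi)^{r-1}\cdot\int_{-\pi}^{\pi}p(x)^r\,dx,$$ where $K_{\rho,u}$ is the expansion coefficient for the uniform distribution on $[-\pi,\pi]$.
   Context: $\mathcal{L}:=\bigcap_{q\ge1}L^q([-\pi,\pi])$ (functions that are $q$-integrable for every $q\ge 1$). $\mathcal{A}$ is the class of probability measures (equivalently densities) on $[-\pi,\pi]$ whose Fourier coefficients are all nonnegative: $\int_{-\pi}^{\pi}e^{-imt}p(t)\,dt\ge 0$ for all $m\in\mathbb{Z}$. For a probability measure $\nu$ on $[-\pi,\pi]$ let $a_\nu(m):=\int_{-\pi}^{\pi}e^{imx}\,d\nu(x)$, $m\in\mathbb{Z}$. Let $\rho=\{B_1,\dots,B_r\}$ be a partition of $\{1,\dots,n\}$. For $N\ge1$ and a multi-index $\mathbf{i}=(i_1,\dots,i_n)\in\{1,\dots,N\}^n$, set $i_0:=i_n$ and $E_b(\mathbf{i}):=\sum_{k\in B_b}(i_{k-1}-i_k)$ for $b=1,\dots,r$. Define $$K_{\rho,\nu,N}:=N^{r-n-1}\sum_{\mathbf{i}\in\{1,\dots,N\}^n}\prod_{b=1}^{r}a_\nu(E_b(\mathbf{i})),$$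 and the (Vandermonde) expansion coefficient $K_{\rho,\nu}:=\lim_{N\to\infty}K_{\rho,\nu,N}$ when the limit exists. (These are the coefficients appearing in $\lim_{N\to\infty}\mathbb{E}[\mathrm{tr}_L(({\bf V}^*{\bf V})^n)]=\sum_{\rho}K_{\rho,\nu}c^{|\rho|-1}$ for the $N\times L$ random Vandermonde matrix ${\bf V}$ with entries ${\bf V}_{k,l}=N^{-1/2}e^{-j(k-1)\theta_l}$, $\theta_l$ i.i.d. with law $\nu$, $L/N\to c$.) $K_{\rho,u}$ denotes $K_{\rho,\nu}$ for $\nu$ the uniform distribution on $[-\pi,\pi]$, for which $K_{\rho,u}=\lim_N N^{r-n-1}\#\{\mathbf{i}: E_b(\mathbf{i})=0\ \forall b\}$. *)

(* Defs.v *)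
From mathcomp Require Import all_boot all_order all_algebra.
From mathcomp Require Import complex.
From mathcomp Require Import all_classical all_reals all_analysis.
Set Implicit Arguments. Unset Strict Implicit. Unset Printing Implicit Defensive.
Import Order.TTheory GRing.Theory Num.Theory numFieldNormedType.Exports.
Local Open Scope classical_set_scope.
Local Open Scope ring_scope.

Section Defs.
Variable R : realType.

Definition Ipi : set R := `[- pi, pi]%classic.

Definition intpi (f : R -> R) : R :=
  \int[lebesgue_measure]_(x in Ipi) f x.

Definition in_calL (p : R -> R) : Prop :=
  measurable_fun Ipi p /\
  forall q : R, 1 <= q ->
    (\int[lebesgue_measure]_(x in Ipi) ((`|p x| `^ q)%:E) < +oo)%E.

(* \int_{-pi}^{pi} e^{-imt} p(t) dt  (complex integral written out as
   real part + i * imaginary part) *)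
Definition fourier_coef (p : R -> R) (m : int) : R[i] :=
  Complex (intpi (fun t => cos (m%:~R * t) * p t))
          (- intpi (fun t => sin (m%:~R * t) * p t)).

(* p belongs to \mathcal{A}: all Fourier coefficients are >= 0 (in C,
   i.e. real and nonnegative) *)
Definition in_calA (p : R -> R) : Prop :=
  forall m : int, 0 <= fourier_coef p m.

Definition is_density (p : R -> R) : Prop :=
  measurable_fun Ipi p /\ (forall x, Ipi x -> 0 <= p x) /\
  (\int[lebesgue_measure]_(x in Ipi) (p x)%:E = 1)%E.

(* a_nu(m) = \int e^{imx} d nu(x) = \int e^{imx} p(x) dx for nu = p dx *)
Definition a_nu (p : R -> R) (m : int) : R[i] :=
  Complex (intpi (fun x => cos (m%:~R * x) * p x))
          (intpi (fun x => sin (m%:~R * x) * p x)).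

(* E_B(i) = \sum_{k in B} (i_{k-1} - i_k) with i_0 := i_n (cyclic
   predecessor ord_pred; indices are 0-based: k : 'I_n stands for k+1,
   and i_k : 'I_N stands for the value i_k + 1 in {1..N}) *)
Definition E_blk (n N : nat) (B : {set 'I_n}) (i : {ffun 'I_n -> 'I_N}) : int :=
  \sum_(k in B) ((i (ord_pred k))%:Z - (i k)%:Z).

Definition K_N (p : R -> R) (n : nat) (P : {set {set 'I_n}}) (N : nat) : R[i] :=
  ((N%:R : R[i]) ^ (#|P|%:Z - n%:Z - 1)) *
  \sum_(i : {ffun 'I_n -> 'I_N}) \prod_(B in P) a_nu p (E_blk B i).

Definition cvgC (u : nat -> R[i]) (l : R[i]) : Prop :=
  ((fun N => complex.Re (u N)) @ \oo --> complex.Re l) /\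
  ((fun N => complex.Im (u N)) @ \oo --> complex.Im l).

Definition unif_density : R -> R := fun _ => (2 * pi)^-1.

End Defs.

(* Main.v *)
Require Import Defs.
From mathcomp Require Import all_boot all_order all_algebra.
From mathcomp Require Import complex.
From mathcomp Require Import all_classical all_reals all_analysis.
From mathcomp Require Import measurable_realfun.
From mathcomp Require Import ring lra zify.
Import Order.TTheory GRing.Theory Num.Theory numFieldNormedType.Exports.

(* Expanding the product over blocks according to the values e_B = E_B(i),
   K_N = sum_e w_N(e) prod_B a(e_B), where w_N(e) = N^(r-n-1) #{i : E_B(i) = e_B}
   vanishes unless sum_B e_B = 0.  Solving the linear system E_B(i) = e_B along a
   spanning tree of the graph of blocks shows that w_N(e) <= 1 is the proportion of
   the points x of {0, ..., N-1}^n at which r - 1 nonzero integer linear forms,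
   shifted by constants depending on e, take values in [0, N).  A nonzero form takes
   a given value at most N^(n-1) times, so shifting the forms or passing from N to qN
   changes this proportion by O(1/N): it converges to a limit K_u that does not
   depend on e.

   Since a >= 0, dominated convergence gives K_N -> K_u sum_{e : sum e_B = 0} prod a(e_B),
   an iterated convolution of the Fourier coefficients of p.  It is computed by applying
   r times Parseval's formula to p and p^k cos(m x), both in L^2 because p has moments
   of all orders.  Parseval's formula for p follows from the density of trigonometric
   polynomials in L^2, obtained from explicit trigonometric polynomials converging
   boundedly to indicators of half-lines. *)

Local Open Scope ring_scope.

(** * Counting lattice points *)

Section LatticeCount.
Context {n : nat}.
Implicit Types (N q C : nat) (a : 'I_n -> int).

Definition lin_form {N} a (x : {ffun 'I_n -> 'I_N}) : int := \sum_j a j * (x j : nat)%:Z.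

(** As [a j0 != 0], the value [c] and the other coordinates determine [x j0], so forgetting that
    coordinate is injective on the fiber. *)
Lemma card_lin_fiber N a j0 c : a j0 != 0 ->
  (#|[set x : {ffun 'I_n -> 'I_N} | lin_form a x == c]| <= N ^ n.-1)%N.
Proof.
move=> a0.
pose f (x : {ffun 'I_n -> 'I_N}) : {ffun 'I_n.-1 -> 'I_N} := [ffun k => x (lift j0 k)].
have -> : (N ^ n.-1 = #|{ffun 'I_n.-1 -> 'I_N}|)%N by rewrite card_ffun !card_ord.
rewrite -(@card_in_imset _ _ f); first exact: max_card.
move=> x y; rewrite !inE => /eqP xc /eqP yc /ffunP fxy.
have off k : k != j0 -> x k = y k.
  case: (unliftP j0 k) => [i ->|->]; last by rewrite eqxx.
  by have := fxy i; rewrite !ffunE.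
have : a j0 * (x j0 : nat)%:Z = a j0 * (y j0 : nat)%:Z.
  have rest : \sum_(j | j != j0) a j * (x j : nat)%:Z = \sum_(j | j != j0) a j * (y j : nat)%:Z.
    by apply: eq_bigr => k /off ->.
  move: xc; rewrite -yc /lin_form (bigD1 j0 _)//= [in RHS](bigD1 j0 _)//= rest.
  exact: addIr.
move/(mulfI a0) => [xy]; apply/ffunP => k.
by have [->|/off//] := eqVneq k j0; apply: val_inj.
Qed.

Lemma card_bigcup_le (J X : finType) (F : J -> {set X}) (r : seq J) (Q : pred J) m :
  (forall j, Q j -> (#|F j| <= m)%N) ->
  (#|\bigcup_(j <- r | Q j) F j| <= \sum_(j <- r | Q j) m)%N.
Proof.
move=> Fm; apply: (big_ind2 (fun (S : {set X}) k => #|S| <= k)%N) => //.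
  by rewrite cards0.
move=> S k S' k' Sk S'k; apply: leq_trans (leq_add Sk S'k).
by rewrite cardsU leq_subr.
Qed.

(** The strip is the union of the [2C + 1] fibers over the integers from [c - C] to [c + C]. *)
Lemma card_lin_strip N a j0 c C : a j0 != 0 ->
  (#|[set x : {ffun 'I_n -> 'I_N} | `|lin_form a x - c| <= C]| <= C.*2.+1 * N ^ n.-1)%N.
Proof.
move=> a0.
pose F (v : 'I_C.*2.+1) := [set x : {ffun 'I_n -> 'I_N} | lin_form a x == c + v%:Z - C%:Z].
apply: (@leq_trans #|\bigcup_v F v|); last first.
  apply: leq_trans (card_bigcup_le _ _ F _ _ (N ^ n.-1) _) _.
    by move=> v _; exact: card_lin_fiber a0.
  by rewrite sum_nat_const card_ord.
apply/subset_leq_card/fintype.subsetP => x; rewrite inE => xc.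
have vC : (absz (lin_form a x - c + C%:Z)%R < C.*2.+1)%N by lia.
apply/finset.bigcupP; exists (Ordinal vC) => //; rewrite inE /=; lia.
Qed.

Context (T : {set 'I_n}) (A : 'I_n -> 'I_n -> int).

(* The points whose membership in [in_box] a perturbation of the forms by at most [C]
   can change. *)
Definition near_walls N C : {set {ffun 'I_n -> 'I_N}} :=
  [set x | [exists (t | t \in T), (`|lin_form (A t) x| <= C) || (`|lin_form (A t) x - N%:Z| <= C)]].

Definition in_box N (d : 'I_n -> int) : {set {ffun 'I_n -> 'I_N}} :=
  [set x | [forall (t | t \in T), 0 <= lin_form (A t) x + d t < N%:Z]].

Hypothesis A_neq0 : forall t, t \in T -> exists j, A t j != 0.

Lemma card_near_walls N C :
  (#|near_walls N C| <= #|T| * (C.*2.+1).*2 * N ^ n.-1)%N.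
Proof.
pose F t := [set x : {ffun 'I_n -> 'I_N} | `|lin_form (A t) x - 0| <= C] :|:
            [set x | `|lin_form (A t) x - N%:Z| <= C].
apply: (@leq_trans #|\bigcup_(t in T) F t|); last first.
  apply: leq_trans (card_bigcup_le _ _ F _ _ ((C.*2.+1).*2 * N ^ n.-1)%N _) _.
    move=> t /A_neq0[j aj]; rewrite -addnn mulnDl.
    apply: leq_trans (leq_add (card_lin_strip N _ _ 0 C aj) (card_lin_strip N _ _ N%:Z C aj)).
    by rewrite cardsU leq_subr.
  by rewrite sum_nat_const mulnA.
apply/subset_leq_card/fintype.subsetP => x; rewrite inE => /existsP[t /andP[tT h]].
by apply/finset.bigcupP; exists t => //; rewrite !inE subr0.
Qed.

(** A form at distance more than [D] from both 0 and [N] stays on the same side of each wall under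
    every shift bounded by [D]. *)
Lemma in_box_shift N d d' D : (forall t, t \in T -> `|d t| <= D%:Z) ->
  (forall t, t \in T -> `|d' t| <= D%:Z) ->
  in_box N d \subset in_box N d' :|: near_walls N D.
Proof.
move=> dD d'D; apply/fintype.subsetP => x; rewrite inE => /forallP h.
rewrite finset.in_setU; case: (boolP (x \in near_walls N D)); rewrite ?orbT// orbF inE.
move=> /existsPn nw; rewrite inE; apply/forallP => t; apply/implyP => tT.
move: (h t) (nw t); rewrite tT /= => {}h {}nw.
have := dD _ tT; have := d'D _ tT.
move: h nw; set l := lin_form _ _; lia.
Qed.

Lemma digit_proof {N q} (i : 'I_N) (s : 'I_q) : (i * q + s < N * q)%N.
Proof. by have := ltn_ord i; have := ltn_ord s; nia. Qed.

(** Base-[q] expansion in each coordinate, leading digit in [u.1] and last digit in [u.2]: it cuts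
    the cube of side [N * q] into cells of side [q], one for each point of the cube of side [N]. *)
Definition join_digits {N q} (u : {ffun 'I_n -> 'I_N} * {ffun 'I_n -> 'I_q}) :
    {ffun 'I_n -> 'I_(N * q)} := [ffun j => Ordinal (digit_proof (u.1 j) (u.2 j))].

Lemma join_digits_bij {N q} : bijective (@join_digits N q).
Proof.
apply: inj_card_bij; last first.
  by rewrite card_prod !card_ffun !card_ord expnMn.
move=> [x s] [y r] /ffunP xy; congr (_, _); apply/ffunP => j; apply: val_inj;
  have := xy j; rewrite !ffunE => /(congr1 val) /= E.
  have := congr1 (divn^~ q) E.
  have q0 : (0 < q)%N := leq_ltn_trans (leq0n _) (ltn_ord (s j)).
  by rewrite /= !divnMDl// !divn_small// !addn0.
by have := congr1 (modn^~ q) E; rewrite /= !modnMDl !modn_small.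
Qed.

Lemma lin_form_join {N q} a (x : {ffun 'I_n -> 'I_N}) (s : {ffun 'I_n -> 'I_q}) :
  lin_form a (join_digits (x, s)) = q%:Z * lin_form a x + lin_form a s.
Proof.
rewrite /lin_form mulr_sumr -big_split; apply: eq_bigr => j _ /=.
by rewrite ffunE /= PoszD PoszM; ring.
Qed.

Lemma lin_form_bound {q} a (s : {ffun 'I_n -> 'I_q}) :
  `|lin_form a s| <= ((\sum_j `|a j|) * q)%N%:Z.
Proof.
rewrite /lin_form; apply: le_trans (ler_norm_sum _ _ _) _.
rewrite PoszM (big_morph Posz PoszD (erefl 0%:Z)) mulr_suml.
apply: ler_sum => j _; rewrite normrM abszE ler_wpM2l//.
by have := ltn_ord (s j); lia.
Qed.

(** The form equals [q * l + l'] with [|l'| <= q * C]. If [l] is farther than [C] from 0 and from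
    [N], the last digits cannot push it across a wall. *)
Lemma in_box_join N q C (x : {ffun 'I_n -> 'I_N}) (s : {ffun 'I_n -> 'I_q}) :
  (0 < q)%N -> (forall t, t \in T -> (\sum_j `|A t j| <= C)%N) -> x \notin near_walls N C ->
  (join_digits (x, s) \in in_box (N * q) (fun=> 0)) = (x \in in_box N (fun=> 0)).
Proof.
move=> q0 AC; rewrite inE => /existsPn nw; rewrite !inE; apply: eq_forallb => t.
case: (boolP (t \in T)) => //= tT; have := nw t; rewrite tT /= negb_or !addr0.
rewrite lin_form_join; have := lin_form_bound (A t) s; have := AC _ tT.
set l := lin_form (A t) x; set c := (\sum_j _)%N; set l' := lin_form _ s.
move=> cC h1 /andP[h2 h3].
have h4 : `|l'| <= q%:Z * C%:Z by nia.
apply/idP/idP => /andP[h5 h6]; apply/andP; split; nia.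
Qed.

(** Away from the walls a cell of [q ^ n] points lies entirely inside or entirely outside the box,
    so only the cells over [near_walls] contribute an error. *)
Lemma card_in_box_scale N q C : (0 < q)%N ->
  (forall t, t \in T -> (\sum_j `|A t j| <= C)%N) ->
  (#|in_box (N * q) (fun=> 0)| <= (#|in_box N (fun=> 0)| + #|near_walls N C|) * q ^ n)%N /\
  (#|in_box N (fun=> 0)| * q ^ n <= #|in_box (N * q) (fun=> 0)| + #|near_walls N C| * q ^ n)%N.
Proof.
move=> q0 AC.
have cq : #|[set: {ffun 'I_n -> 'I_q}]| = (q ^ n)%N by rewrite cardsT card_ffun !card_ord.
rewrite -(on_card_preimset (onW_bij _ (@join_digits_bij N q))) -cq; split.
  apply: (@leq_trans #|finset.setX (in_box N (fun=> 0) :|: near_walls N C) [set: {ffun 'I_n -> 'I_q}]|).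
    apply/subset_leq_card/fintype.subsetP => -[x s].
    rewrite finset.in_setX finset.in_setT andbT finset.in_setU finset.inE.
    by case: (boolP (x \in near_walls N C)) => [|xw]; rewrite ?orbT// (in_box_join _ _ _ _ _ q0 AC xw) orbF.
  by rewrite cardsX leq_mul2r cardsU leq_subr orbT.
apply: (@leq_trans (#|finset.setX (in_box N (fun=> 0) :\: near_walls N C) [set: {ffun 'I_n -> 'I_q}]|
    + #|near_walls N C| * #|[set: {ffun 'I_n -> 'I_q}]|)%N).
  rewrite cardsX -mulnDl leq_mul2r; apply/orP; right.
  rewrite -[X in (X <= _)%N](cardsID (near_walls N C)) addnC leq_add2l.
  by apply/subset_leq_card; exact: subsetIr.
rewrite leq_add2r; apply/subset_leq_card/fintype.subsetP => -[x s].
rewrite finset.in_setX finset.in_setD finset.in_setT andbT => /andP[xw xb].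
by rewrite finset.inE (in_box_join _ _ _ _ _ q0 AC xw).
Qed.

End LatticeCount.

(** * Limit of the proportion of lattice points in a box *)

Section BoxDensity.
Context {R : realType} {n : nat} (n0 : (0 < n)%N).
Context (T : {set 'I_n}) (A : 'I_n -> 'I_n -> int).
Hypothesis A_neq0 : forall t, t \in T -> exists j, A t j != 0.

Definition box_density d N : R := #|in_box T A N d|%:R / N%:R ^+ n.

(** For [N > 0], [wall D / N] bounds the proportion of points of the cube that lie in
    [near_walls]. *)
Let wall D : R := (#|T| * (D.*2.+1).*2)%:R.

Let frac_addE b c N : (0 < N)%N ->
  b%:R / N%:R ^+ n + c%:R / N%:R = (b + c * N ^ n.-1)%:R / N%:R ^+ n :> R.
Proof.
move=> N0; have N0' : (0 : R) < N%:R by rewrite ltr0n.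
rewrite natrD mulrDl natrM natrX; congr (_ + _).
have y0 : (N%:R ^+ n.-1 : R) != 0 by rewrite expf_neq0// gt_eqF.
rewrite -[in X in _ = _ / X](prednK n0) exprS; move: y0; set y := _ ^+ n.-1 => y0.
by field; rewrite y0 gt_eqF.
Qed.

Lemma box_density_shift d d' D N : (forall t, t \in T -> `|d t| <= D%:Z) ->
  (forall t, t \in T -> `|d' t| <= D%:Z) -> (0 < N)%N ->
  box_density d N <= box_density d' N + wall D / N%:R.
Proof.
move=> dD d'D N0; have N0' : (0 : R) < N%:R by rewrite ltr0n.
rewrite frac_addE// ler_pM2r ?invr_gt0 ?exprn_gt0// ler_nat.
apply: leq_trans (subset_leq_card (in_box_shift _ _ _ _ _ _ dD d'D)) _.
apply: leq_trans (leq_card_setU _ _) _.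
by rewrite leq_add2l; exact: card_near_walls.
Qed.

Lemma box_density_scale : exists C, forall N q, (0 < N)%N -> (0 < q)%N ->
  `|box_density (fun=> 0) (N * q) - box_density (fun=> 0) N| <= wall C / N%:R.
Proof.
pose C := (\max_(t in T) \sum_j `|A t j|)%N; exists C => N q N0 q0.
have AC t : t \in T -> (\sum_j `|A t j| <= C)%N.
  by move=> tT; exact: (@leq_bigmax_cond _ _ (fun t => \sum_j `|A t j|)%N).
have [h1 h2] := card_in_box_scale T _ N q C q0 AC.
have hw := card_near_walls T _ A_neq0 N C.
have N0' : (0 : R) < N%:R ^+ n by rewrite exprn_gt0// ltr0n.
have q0' : (0 : R) < q%:R ^+ n by rewrite exprn_gt0// ltr0n.
have E (k : nat) : k%:R / N%:R ^+ n = (k * q ^ n)%:R / (N * q)%:R ^+ n :> R.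
  by rewrite !natrM natrX exprMn -mulf_div divff ?gt_eqF// mulr1.
have Nq0 : (0 : R) < (N * q)%:R ^+ n by rewrite exprn_gt0// ltr0n muln_gt0 N0.
rewrite ler_norml; apply/andP; split.
  rewrite lerNl opprB lerBlDr addrC.
  have := frac_addE 0 (#|T| * (C.*2.+1).*2) N N0.
  rewrite mul0r add0r add0n => ->.
  rewrite [X in X <= _]E [X in _ <= _ + X]E -mulrDl ler_pM2r ?invr_gt0// -natrD ler_nat.
  by apply: leq_trans h2 _; rewrite leq_add2l leq_mul2r hw orbT.
rewrite lerBlDr addrC frac_addE// [leRHS]E ler_pM2r ?invr_gt0// ler_nat.
by apply: leq_trans h1 _; rewrite leq_mul2r leq_add2l hw orbT.
Qed.

Local Open Scope classical_set_scope.

(** Without shift the densities form a Cauchy sequence, by the comparison of [N] with its multiples.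
    A shift by [d] costs O(1/N), so the limit is the same for every [d]. *)
Lemma box_density_cvg : exists l : R, forall d, box_density d @ \oo --> l.
Proof.
have [C hC] := box_density_scale.
have wall0 D : (fun N => wall D / N%:R) @ \oo --> (0 : R).
  rewrite -[X in _ --> X](mulr0 (wall D)); apply: cvgM; first exact: cvg_cst.
  by rewrite -cvg_shiftS; exact: cvg_harmonic.
have c0 : cvg (box_density (fun=> 0) @ \oo).
  (* compare the densities at [N0] and [N] through [N0 * N] *)
  apply/cauchy_cvgP/cauchy_exP => e e0.
  have e2 : 0 < e / 2 by lra.
  have /cvgr_lt /(_ _ e2) [N0 _ hN0] := wall0 C.
  have w0 N : (N0 <= N)%N -> wall C / N.+1%:R < e / 2.
    by move=> h; apply: hN0 => /=; exact: leqW.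
  exists (box_density (fun=> 0) N0.+1); exists N0.+1 => // -[//|N] /= hN.
  rewrite /ball /=.
  have := hC N0.+1 N.+1 isT isT; have := hC N.+1 N0.+1 isT isT.
  have := w0 N0 (leqnn _); have := w0 N hN; rewrite mulnC.
  set a := box_density _ _; set b := box_density _ _; set c := box_density _ _.
  move: (wall C / N.+1%:R) (wall C / N0.+1%:R) => u v.
  rewrite !ler_norml ltr_norml => h1 h2 /andP[h3 h4] /andP[h5 h6].
  by apply/andP; split; lra.
exists (lim (box_density (fun=> 0) @ \oo)) => d.
pose D := (\max_(t in T) `|d t|)%N.
have dD t : t \in T -> `|d t| <= D%:Z.
  by move=> tT; rewrite -abszE lez_nat; exact: (@leq_bigmax_cond _ _ (fun t => `|d t|)%N).
have zD t : t \in T -> `|(fun=> 0 : int) t| <= D%:Z by rewrite normr0.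
apply/cvgrPdist_lt => e e0; have e2 : 0 < e / 2 by lra.
have /cvgr_lt /(_ _ e2) [N0 _ hN0] := wall0 D.
move/cvgrPdist_lt : c0 => /(_ _ e2) [N1 _ hN1].
exists (maxn N0.+1 N1) => // N /=; rewrite geq_max => /andP[hN /hN1 /=].
have N_gt0 : (0 < N)%N by exact: leq_trans hN.
have := hN0 N (ltnW hN); have := box_density_shift _ _ _ _ dD zD N_gt0.
have := box_density_shift _ _ _ _ zD dD N_gt0.
move: (wall D / N%:R) => u.
rewrite !ltr_norml /= => h1 h2 h3 /andP[h4 h5].
by apply/andP; split; lra.
Qed.

End BoxDensity.

(** * The linear system of the blocks *)

Section TreeReduction.
Context {m : nat}.
Notation n := m.+1.
Context (P : {set {set 'I_n}}) (hP : finset.partition P [set: 'I_n]).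
Implicit Types (v w y : 'I_n -> int) (B : {set 'I_n}).

Definition block_flow B v : int := \sum_(k in B) (v (ord_pred k) - v k).

(** These coefficients form a row of the incidence matrix of the graph of blocks, in which edge [l]
    leads from the block of [l] to the block of [ordS l]; loops get coefficient 0. *)
Lemma block_flowE B v :
  block_flow B v = \sum_l ((ordS l \in B)%:R - (l \in B)%:R) * v l.
Proof.
rewrite /block_flow big_split sumrN /=.
rewrite (reindex (@ordS n)) /=; last first.
  by apply: onW_bij; exists (@ord_pred n); [exact: ordSK|exact: ord_predK].
rewrite (eq_bigr (fun j => v j)); last by move=> j _; rewrite ordSK.
rewrite [X in X - _]big_mkcond [X in _ - X]big_mkcond -sumrB.
apply: eq_bigr => l _; rewrite mulrBl.
by case: ifP => _; case: ifP => _; rewrite ?mul1r ?mul0r.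
Qed.

Lemma block_flow_cst B c : block_flow B (fun=> c) = 0.
Proof. by rewrite /block_flow big1// => k _; rewrite subrr. Qed.

(** Each [v k] occurs once with each sign as the blocks cover the cycle. Thus one block equation is
    redundant, and prescribed values must sum to 0. *)
Lemma sum_block_flow v : \sum_(B in P) block_flow B v = 0.
Proof.
rewrite -(set_partition_big _ hP) /= big_split sumrN /=.
rewrite (reindex (@ordS n)) /=; last first.
  by apply: onW_bij; exists (@ord_pred n); [exact: ordSK|exact: ord_predK].
apply/eqP; rewrite subr_eq0; apply/eqP; apply: eq_big => [j|j _]; first by rewrite !inE.
by rewrite ordSK.
Qed.

Definition next_block (j : 'I_n) : {set 'I_n} := finset.pblock P (ordS j).

(* The edges entering each block at its first visit along the cycle 0, 1, ..., n - 1
   form a spanning tree of the graph of blocks. *)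
Definition tree : {set 'I_n} :=
  [set j : 'I_n | (j.+1 < n)%N && [forall (k | k \in next_block j), (ordS j <= k)%N]].

Lemma cover_all k : k \in finset.cover P.
Proof. by have /and3P[/eqP -> _ _] := hP; rewrite inE. Qed.

Lemma next_blockP j : next_block j \in P.
Proof. by rewrite finset.pblock_mem// cover_all. Qed.

Lemma ordS_next_block j : ordS j \in next_block j.
Proof. by rewrite finset.mem_pblock cover_all. Qed.

Lemma ordS_tree j : j \in tree -> ordS j = j.+1 :> nat.
Proof. by rewrite inE => /andP[jn _]; rewrite /= modn_small. Qed.

Lemma tree_min j k : j \in tree -> k \in next_block j -> (j < k)%N.
Proof.
move=> jT kB; have := ordS_tree _ jT; move: jT; rewrite inE => /andP[_ /forallP/(_ k)].
by rewrite kB /= => + <-.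
Qed.

(** A tree edge carries the flow equation of the block that it enters; every other edge is a free
    variable, kept by an identity row. *)
Definition tree_mx : 'M[int]_n := \matrix_(j, l)
  if j \in tree then (ordS l \in next_block j)%:R - (l \in next_block j)%:R
  else (j == l)%:R.

(** The block entered by a tree edge [j] contains only indices above [j]. Hence the matrix is upper
    triangular with ones on the diagonal, and its inverse is integral. *)
Lemma tree_mx_unit : tree_mx \in unitmx.
Proof.
rewrite unitmxE -det_tr det_trig; last first.
  apply/is_trig_mxP => l j lj; rewrite !mxE; case: ifP => [jT|_]; last first.
    by rewrite -val_eqE /= gtn_eqF.
  have nl : l \notin next_block j by apply/negP => /(tree_min _ _ jT); lia.
  have nSl : ordS l \notin next_block j.
    apply/negP => /(tree_min _ _ jT); have := ltn_ord j.
    by rewrite /= => jn; rewrite modn_small; lia.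
  by rewrite (negbTE nl) (negbTE nSl).
rewrite big1 ?unitr1// => j _; rewrite !mxE; case: ifP => [jT|_]; last by rewrite eqxx.
rewrite ordS_next_block; have -> : (j \in next_block j) = false.
  by apply/negP => /(tree_min _ _ jT); rewrite ltnn.
by rewrite subr0.
Qed.

Lemma tree_mxE v j : (tree_mx *m \col_l v l) j 0 =
  if j \in tree then block_flow (next_block j) v else v j.
Proof.
rewrite mxE; case: ifP => jT.
  by rewrite block_flowE; apply: eq_bigr => l _; rewrite !mxE jT.
rewrite (bigD1 j)//= !mxE jT eqxx mul1r big1 ?addr0// => l lj.
by rewrite !mxE jT eq_sym (negbTE lj) mul0r.
Qed.

Definition tree_inv : 'M[int]_n := invmx tree_mx.

Lemma tree_solve v y :
  (forall j, (if j \in tree then block_flow (next_block j) v else v j) = y j) <->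
  (forall t, v t = \sum_j tree_inv t j * y j).
Proof.
have e1 v' w' : (\col_l v' l : 'cV[int]_n) = \col_l w' l -> v' =1 w'.
  by move/matrixP => E t; have := E t 0; rewrite !mxE.
split=> h.
  have : tree_mx *m \col_l v l = \col_l y l.
    by apply/matrixP => j i; rewrite ord1 tree_mxE h mxE.
  move/(congr1 (mulmx tree_inv)); rewrite mulmxA mulVmx ?tree_mx_unit// mul1mx.
  by move/matrixP => E t; have := E t 0; rewrite !mxE => ->; apply: eq_bigr => j _; rewrite mxE.
move=> j; rewrite -tree_mxE.
have -> : \col_l v l = tree_inv *m \col_l y l.
  by apply/matrixP => t i; rewrite ord1 mxE h mxE; apply: eq_bigr => k _; rewrite mxE.
by rewrite mulmxA mulmxV ?tree_mx_unit// mul1mx mxE.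
Qed.

(** The part of row [t] of the inverse that acts on the free variables; the tree columns, applied to
    the prescribed values, give the constant [tree_shift]. *)
Definition tree_form t j : int := if j \in tree then 0 else tree_inv t j.

(** The constant vector 1 has zero flow through every block, so solving for it writes 1 as the sum
    of the free coefficients in row [t]. *)
Lemma tree_form_neq0 t : exists j, tree_form t j != 0.
Proof.
apply/existsP; apply: contraT => /existsPn h.
have /tree_solve/(_ t) : forall j, (if j \in tree then block_flow (next_block j) (fun=> 1) else 1)
    = (if j \in tree then 0 else 1 : int).
  by move=> j; rewrite block_flow_cst.
rewrite big1 => [/eqP|j _]; first by rewrite oner_eq0.
have := h j; rewrite negbK /tree_form => /eqP; case: ifP => _ E; first by rewrite mulr0.
by rewrite E mul0r.
Qed.

Context (e : {set 'I_n} -> int) (e0 : \sum_(B in P) e B = 0).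

Definition tree_shift t : int := \sum_(j in tree) tree_inv t j * e (next_block j).

(** If the least element [k] of [B] were positive, the edge from [k - 1] to [k] would be a tree edge
    entering [B]. *)
Lemma root_block B : B \in P -> (forall j, j \in tree -> next_block j != B) -> ord0 \in B.
Proof.
move=> BP nB; have /and3P[/eqP cP tP n0] := hP.
have /set0Pn[k0 kB0] : B != finset.set0 by apply: contraNneq n0 => <-.
have [k kB kmin] := arg_minnP (fun k : 'I_n => k : nat) kB0.
have [kz|k0'] := posnP k.
  by rewrite (_ : ord0 = k)//; apply: val_inj.
have kE : ordS (ord_pred k) = k by exact: ord_predK.
have nbE : next_block (ord_pred k) = B by rewrite /next_block kE; exact: finset.def_pblock.
have /nB : ord_pred k \in tree.
  rewrite inE nbE kE; apply/andP; split; last by apply/forallP => j; apply/implyP; exact: kmin.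
  have := ltn_ord k; rewrite /= => kn.
  have -> : ((k + n).-1 %% n = k.-1)%N.
    have -> : ((k + n).-1 = k.-1 + n)%N by lia.
    by rewrite modnDr modn_small//; lia.
  by lia.
by rewrite nbE eqxx.
Qed.

Lemma tree_not_root j : j \in tree -> ord0 \notin next_block j.
Proof. by move=> jT; apply/negP => /(tree_min _ _ jT). Qed.

(** A tree edge enters every block except the one containing 0. The equation of that block follows
    from the others, as flows and prescribed values both sum to 0. *)
Lemma flow_treeP v :
  (forall B, B \in P -> block_flow B v = e B) <->
  (forall j, j \in tree -> block_flow (next_block j) v = e (next_block j)).
Proof.
split=> [h j _|h]; first by apply: h; exact: next_blockP.
have /and3P[/eqP cP tP n0] := hP.
pose B0 := finset.pblock P ord0.
have B0P : B0 \in P by rewrite finset.pblock_mem// cover_all.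
have hB B : B \in P -> B != B0 -> block_flow B v = e B.
  move=> BP BB0; have [/existsP[j /andP[jT /eqP <-]]|/existsPn nB] :=
    boolP [exists j, (j \in tree) && (next_block j == B)]; first exact: h.
  have : ord0 \in B.
    by apply: root_block => // j jT; have := nB j; rewrite jT.
  by move=> zB; move/eqP : BB0; case; rewrite /B0 (finset.def_pblock tP BP zB).
move=> B BP; have [->|] := eqVneq B B0; last exact: hB.
have := sum_block_flow v; rewrite (bigD1 B0)//=; have := e0; rewrite (bigD1 B0)//=.
rewrite [in X in _ -> X = _ -> _](eq_bigr e); last by move=> C /andP[]; exact: hB.
by move=> /eqP; rewrite addr_eq0 => /eqP -> /eqP; rewrite addr_eq0 => /eqP ->.
Qed.

(** [next_block] maps the tree bijectively onto the blocks other than the one containing 0. *)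
Lemma card_tree : #|tree|.+1 = #|P|.
Proof.
have /and3P[/eqP cP tP n0] := hP.
pose B0 := finset.pblock P ord0.
have B0P : B0 \in P by rewrite finset.pblock_mem// cover_all.
rewrite (cardsD1 B0) B0P add1n; congr _.+1.
rewrite -(@card_in_imset _ _ next_block); last first.
  move=> i j iT jT ij; apply: val_inj.
  have := tree_min _ _ iT (_ : ordS j \in next_block i).
  have := tree_min _ _ jT (_ : ordS i \in next_block j).
  rewrite ij -{1}ij !ordS_next_block (ordS_tree _ iT) (ordS_tree _ jT).
  by move=> /(_ isT) h1 /(_ isT) h2 /=; lia.
apply: eq_card => B; apply/imsetP/idP => [[j jT ->]|].
  rewrite finset.in_setD1 next_blockP andbT; apply: contra (tree_not_root _ jT) => /eqP ->.
  by rewrite finset.mem_pblock cover_all.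
rewrite finset.in_setD1 => /andP[BB0 BP].
have [/existsP[j /andP[jT /eqP <-]]|/existsPn nB] :=
    boolP [exists j, (j \in tree) && (next_block j == B)]; first by exists j.
have zB : ord0 \in B by apply: root_block => // j jT; have := nB j; rewrite jT.
by move/eqP : BB0; case; rewrite /B0 (finset.def_pblock tP BP zB).
Qed.

Definition solutions N : {set {ffun 'I_n -> 'I_N}} :=
  [set i | [forall (B | B \in P), E_blk B i == e B]].

Lemma solutionsP N (i : {ffun 'I_n -> 'I_N}) :
  reflect (forall t, (i t : nat)%:Z = \sum_j tree_inv t j *
     (if j \in tree then e (next_block j) else (i j : nat)%:Z)) (i \in solutions N).
Proof.
have EE : (forall B, B \in P -> block_flow B (fun j => (i j : nat)%:Z) = e B) <-> i \in solutions N.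
  rewrite inE; split=> [h|/forallP h B BP].
    by apply/forallP => B; apply/implyP => /h <-.
  by have := h B; rewrite BP /= => /eqP.
apply: (iffP idP) => [/EE/flow_treeP h|h].
  apply/(tree_solve (fun j => (i j : nat)%:Z)
    (fun j => if j \in tree then e (next_block j) else (i j : nat)%:Z)) => j.
  by case: ifP => // /h.
apply/EE/flow_treeP => j jT; move/tree_solve : h => /(_ j); by rewrite jT.
Qed.

Lemma tree_sumE N (x : {ffun 'I_n -> 'I_N}) t :
  \sum_j tree_inv t j * (if j \in tree then e (next_block j) else (x j : nat)%:Z) =
  lin_form (tree_form t) x + tree_shift t.
Proof.
rewrite /lin_form /tree_shift [X in _ + X]big_mkcond -big_split; apply: eq_bigr => j _ /=.
by rewrite /tree_form; case: ifP => _; rewrite ?mul0r ?add0r ?addr0.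
Qed.

Lemma card_agree N (i : {ffun 'I_n -> 'I_N}) :
  #|[set x : {ffun 'I_n -> 'I_N} | [forall (j | j \notin tree), i j == x j]]| = (N ^ #|tree|)%N.
Proof.
pose F j : pred 'I_N := if j \in tree then predT else pred1 (i j).
transitivity #|family F|.
  apply: eq_card => x; rewrite inE; apply/forallP/familyP => h j.
    by have := h j; rewrite /F; case: ifP => //= _ /eqP ->; rewrite inE.
  by have := h j; rewrite /F; case: ifP => //= _; rewrite inE eq_sym.
rewrite card_family foldrE big_map big_enum /=.
rewrite -prod_nat_const [RHS]big_mkcond; apply: eq_bigr => j _.
by rewrite /F; case: ifP => _; rewrite ?card1// card_ord.
Qed.

(* On the left the variables of the tree edges are free, in a solution they are
   determined by the other ones. *)
Lemma card_in_box_tree N :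
  #|in_box tree tree_form N tree_shift| = (#|solutions N| * N ^ #|tree|)%N.
Proof.
pose agree (i x : {ffun 'I_n -> 'I_N}) := [forall (j | j \notin tree), i j == x j].
pose w x t := lin_form (tree_form t) x + tree_shift t.
have solE i x : i \in solutions N -> agree i x -> forall t, (i t : nat)%:Z = w N x t.
  move=> /solutionsP iS /forallP ix t; rewrite iS /w -tree_sumE.
  apply: eq_bigr => j _; congr (_ * _); case: ifPn => // jT.
  by have := ix j; rewrite jT => /eqP ->.
(* Exactly one solution agrees with [x] off the tree when [x] is in the box, and none does
   otherwise. *)
have key x : (x \in in_box tree tree_form N tree_shift : nat) = (\sum_(i in solutions N) agree i x)%N.
  have [xb|xb] := boolP (x \in in_box _ _ _ _); last first.
    rewrite big1// => i iS; case: (boolP (agree i x)) => // ix; case/negP: xb.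
    rewrite inE; apply/forallP => t; apply/implyP => tT.
    by have := solE _ _ iS ix t; rewrite /w => <-; have := ltn_ord (i t); lia.
  have wx t : t \notin tree -> w N x t = (x t : nat)%:Z.
    move=> tT; have [_ /(_ _ t)] := tree_solve (w N x)
      (fun j => if j \in tree then e (next_block j) else (x j : nat)%:Z).
    by rewrite (negbTE tT); apply => s; rewrite tree_sumE.
  have wb t : 0 <= w N x t < N%:Z.
    have [tT|/wx ->] := boolP (t \in tree); last by have := ltn_ord (x t); lia.
    by move: xb; rewrite inE => /forallP/(_ t); rewrite tT.
  (* The default [x t] is never taken, since [wb] puts [w N x t] in [0, N). *)
  pose i : {ffun 'I_n -> 'I_N} := [ffun t => insubd (x t) `|w N x t|%N].
  have iw t : (i t : nat)%:Z = w N x t.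
    by rewrite ffunE val_insubd; have := wb t; case: ifP; lia.
  have ix : agree i x.
    apply/forallP => t; apply/implyP => /wx; rewrite -iw => -[E].
    by apply/eqP; apply: val_inj.
  have iS : i \in solutions N.
    apply/solutionsP => t; rewrite iw /w -tree_sumE; apply: eq_bigr => j _.
    congr (_ * _); case: ifPn => // jT.
    by move/forallP : ix => /(_ j); rewrite jT => /eqP ->.
  rewrite (bigD1 i)//= ix big1// => i' /andP[iS' ii'].
  case: (boolP (agree i' x)) => // ix'; case/eqP : ii'; apply/ffunP => t.
  by apply: val_inj; have := solE _ _ iS' ix' t; rewrite -iw => -[].
(* Double counting of the pairs of a solution and a point agreeing with it off the tree: each
   solution has [N ^ #|tree|] such points. *)
rewrite -sum1_card big_mkcond /=.
rewrite (eq_bigr (fun x => \sum_(i in solutions N) agree i x)%N); last first.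
  by move=> x _; rewrite -key; case: (_ \in _).
rewrite exchange_big /= (eq_bigr (fun=> N ^ #|tree|)%N); last first.
  move=> i _; rewrite -(card_agree _ i) -sum1_card [RHS]big_mkcond.
  by apply: eq_bigr => x _; rewrite inE -/(agree i x); case: (agree i x).
by rewrite sum_nat_const.
Qed.

End TreeReduction.

Local Open Scope classical_set_scope.
Local Open Scope ring_scope.

(** * Functions with moments of all orders *)

Section Integration.
Context {R : realType}.
Implicit Types f g h : R -> R.
Notation mu := (@lebesgue_measure R).
Notation D := (@Ipi R).

Definition integrable_pi f : Prop := mu.-integrable D (EFin \o f).

(** Natural exponents make stability under sums and products elementary, and every integral below
    stays within this algebra. *)
Definition all_moments f : Prop :=
  measurable_fun D f /\ forall k, integrable_pi (fun x => `|f x| ^+ k).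

Lemma measurable_Ipi : measurable D.
Proof. exact: measurable_itv. Qed.

Lemma measure_Ipi : mu D = (2 * pi)%:E.
Proof.
have pi0 := @pi_gt0 R.
rewrite /Ipi lebesgue_measure_itv /= ifT; last by rewrite lte_fin; lra.
by congr EFin; lra.
Qed.

Lemma measure_Ipi_fin : (mu D < +oo)%E.
Proof. by rewrite measure_Ipi ltry. Qed.

Lemma integrable_pi_le f g : measurable_fun D f ->
  (forall x, D x -> `|f x| <= g x) -> integrable_pi g -> integrable_pi f.
Proof.
move=> mf fg; apply: le_integrable => //; first exact: measurable_Ipi.
- exact/measurable_EFinP.
- move=> x Dx; rewrite /= lee_fin (le_trans (fg _ Dx))//; exact: ler_norm.
Qed.

Lemma integrable_piD f g : integrable_pi f -> integrable_pi g ->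
  integrable_pi (fun x => f x + g x).
Proof. rewrite /integrable_pi => fi gi; have /(_ measurable_Ipi) := integrableD _ fi gi.
exact. Qed.

Lemma integrable_piZ c f : integrable_pi f -> integrable_pi (fun x => c * f x).
Proof. rewrite /integrable_pi => fi; have /(_ measurable_Ipi) := integrableZl _ c fi.
exact. Qed.

Lemma all_moments_integrable f : all_moments f -> integrable_pi f.
Proof.
move=> [mf fk]; apply: (integrable_pi_le _ _ mf _ (fk 1)) => x Dx.
by rewrite expr1.
Qed.

Lemma all_moments_bounded f c : measurable_fun D f ->
  (forall x, D x -> `|f x| <= c) -> all_moments f.
Proof.
move=> mf fc; split=> // k.
apply: (@integrable_pi_le _ (fun=> `|c| ^+ k)).
- by apply: measurable_funX; exact: measurableT_comp.
- move=> x Dx; rewrite ger0_norm ?exprn_ge0//.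
  by apply: lerXn2r; rewrite ?nnegrE// (le_trans (fc _ Dx))// ler_norm.
- apply: measurable_bounded_integrable => //; first exact: measurable_Ipi.
    exact: measure_Ipi_fin.
  exists (`|c| ^+ k); split; rewrite ?num_real// => M /ltW cM x _ /=.
  by rewrite ger0_norm ?exprn_ge0.
Qed.

Lemma all_moments_cst c : all_moments (fun=> c).
Proof. by apply: (@all_moments_bounded _ `|c|). Qed.

Lemma all_momentsM f g : all_moments f -> all_moments g ->
  all_moments (fun x => f x * g x).
Proof.
move=> [mf fk] [mg gk]; split=> [|k]; first exact: measurable_funM.
(* The product [a * b] of nonnegative numbers is at most [a ^+ 2 + b ^+ 2]. *)
apply: (@integrable_pi_le _ (fun x => `|f x| ^+ (k + k) + `|g x| ^+ (k + k))); last first.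
- exact: integrable_piD.
- move=> x _; rewrite ger0_norm ?exprn_ge0// normrM exprMn !exprD.
  set a := _ ^+ k; set b := _ ^+ k.
  have a0 : 0 <= a by rewrite exprn_ge0.
  have b0 : 0 <= b by rewrite exprn_ge0.
  by nra.
- by apply: measurable_funX; apply: measurableT_comp => //; exact: measurable_funM.
Qed.

Lemma all_momentsZ c f : all_moments f -> all_moments (fun x => c * f x).
Proof. by move=> ?; apply: all_momentsM => //; exact: all_moments_cst. Qed.

Lemma all_momentsX k f : all_moments f -> all_moments (fun x => f x ^+ k).
Proof.
move=> Lf; elim: k => [|k IH]; first exact: all_moments_cst.
under [fun x => _]eq_fun do rewrite exprS.
exact: all_momentsM.
Qed.

Lemma all_momentsD f g : all_moments f -> all_moments g ->
  all_moments (fun x => f x + g x).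
Proof.
move=> [mf fk] [mg gk]; split=> [|k]; first exact: measurable_funD.
apply: (@integrable_pi_le _ (fun x => 2 ^+ k * (`|f x| ^+ k + `|g x| ^+ k))); last first.
- by apply: integrable_piZ; exact: integrable_piD.
- move=> x _; rewrite ger0_norm ?exprn_ge0//.
  wlog fg : f g {mf fk mg gk} / `|f x| <= `|g x|.
    move=> H; have [|/ltW] := leP `|f x| `|g x|; first exact: H.
    by rewrite [f x + g x]addrC [_ ^+ k + _]addrC; exact: H.
  apply: (@le_trans _ _ (2 ^+ k * `|g x| ^+ k)); last first.
    by rewrite ler_wpM2l ?exprn_ge0// lerDr exprn_ge0.
  rewrite -exprMn; apply: lerXn2r; rewrite ?nnegrE ?mulr_ge0//.
  by rewrite (le_trans (ler_normD _ _))// mulr2n mulrDl !mul1r lerD2r.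
- by apply: measurable_funX; apply: measurableT_comp => //; exact: measurable_funD.
Qed.

Lemma all_momentsN f : all_moments f -> all_moments (fun x => - f x).
Proof. by move=> /(all_momentsZ (-1)); under [fun x => _]eq_fun do rewrite mulN1r. Qed.

Lemma all_momentsB f g : all_moments f -> all_moments g ->
  all_moments (fun x => f x - g x).
Proof. by move=> ? ?; apply: all_momentsD => //; exact: all_momentsN. Qed.


Lemma all_moments_sum (J : Type) (s : seq J) (F : J -> R -> R) :
  (forall j, all_moments (F j)) -> all_moments (fun x => \sum_(j <- s) F j x).
Proof.
move=> LF; elim: s => [|j s IH].
  under [fun x => _]eq_fun do rewrite big_nil; exact: all_moments_cst.
under [fun x => _]eq_fun do rewrite big_cons; exact: all_momentsD.
Qed.

Lemma intpiD f g : all_moments f -> all_moments g ->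
  intpi (fun x => f x + g x) = intpi f + intpi g.
Proof.
by move=> Lf Lg; rewrite /intpi RintegralD//;
  [exact: measurable_Ipi | exact: all_moments_integrable..].
Qed.

Lemma intpiZ c f : all_moments f -> intpi (fun x => c * f x) = c * intpi f.
Proof.
by move=> Lf; rewrite /intpi RintegralZl//;
  [exact: measurable_Ipi | exact: all_moments_integrable].
Qed.

Lemma intpiB f g : all_moments f -> all_moments g ->
  intpi (fun x => f x - g x) = intpi f - intpi g.
Proof.
by move=> Lf Lg; rewrite /intpi RintegralB//;
  [exact: measurable_Ipi | exact: all_moments_integrable..].
Qed.

Lemma intpi_sum (J : Type) (s : seq J) (F : J -> R -> R) :
  (forall j, all_moments (F j)) ->
  intpi (fun x => \sum_(j <- s) F j x) = \sum_(j <- s) intpi (F j).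
Proof.
move=> LF; elim: s => [|j s IH].
  rewrite big_nil; under [fun x => _]eq_fun do rewrite big_nil.
  by rewrite /intpi Rintegral_cst ?mul0r//; exact: measurable_Ipi.
rewrite big_cons -IH; under [fun x => _]eq_fun do rewrite big_cons.
by rewrite intpiD//; exact: all_moments_sum.
Qed.

Lemma eq_intpi f g : (forall x, D x -> f x = g x) -> intpi f = intpi g.
Proof. by move=> fg; apply: eq_Rintegral => x /set_mem; exact: fg. Qed.

Lemma le_intpi f g : all_moments f -> all_moments g ->
  (forall x, D x -> f x <= g x) -> intpi f <= intpi g.
Proof.
by move=> Lf Lg fg; apply: le_Rintegral => //;
  [exact: measurable_Ipi | exact: all_moments_integrable..].
Qed.

Lemma intpi_ge0 f : (forall x, D x -> 0 <= f x) -> 0 <= intpi f.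
Proof. by move=> f0; apply: Rintegral_ge0. Qed.

Lemma intpi_cvg0 (f_ : nat -> R -> R) g :
  (forall n, measurable_fun D (f_ n)) ->
  {ae mu, forall x, D x -> f_ ^~ x @ \oo --> 0} ->
  integrable_pi g -> (forall n x, D x -> `|f_ n x| <= g x) ->
  (fun n => intpi (f_ n)) @ \oo --> 0.
Proof.
move=> mf f0 gi fg.
have [] // := @dominated_convergence _ _ _ mu D measurable_Ipi
   (fun n => EFin \o f_ n) (cst 0%E) (EFin \o g).
- by move=> n; apply/measurable_EFinP; exact: mf.
- apply: negligibleS f0 => x /=; apply: contra_not => f0 Dx.
  by apply: cvg_EFin; [exact: nearW|exact: f0].
- by apply: aeW => x n Dx; rewrite /= lee_fin; exact: fg.
move=> _ _; rewrite integral0 => h.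
exact: (fine_cvg h).
Qed.

End Integration.

(** * Density of trigonometric polynomials *)

Section StepPolynomials.
Context {R : realType}.
Implicit Types u y : R.

Lemma bernoulli_ineq y m : -1 <= y -> 1 + m%:R * y <= (1 + y) ^+ m.
Proof.
move=> y1; elim: m => [|m IH]; first by rewrite mul0r addr0 expr0.
rewrite exprS -natr1; apply: (@le_trans _ _ ((1 + y) * (1 + m%:R * y))).
  have := ler0n R m; nra.
by rewrite ler_wpM2l//; lra.
Qed.

(* The polynomials of the elementary proof of the Stone-Weierstrass theorem: they
   separate [u < 1/2] from [u > 1/2]. *)
Lemma step_poly_bounds u n : 0 <= u <= 1 -> 0 <= (1 - u ^+ n) ^+ (2 ^ n) <= 1.
Proof.
move=> /andP[u0 u1]; have un0 : 0 <= u ^+ n by rewrite exprn_ge0.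
have un1 : u ^+ n <= 1 by rewrite exprn_ile1.
by rewrite exprn_ge0 ?exprn_ile1//; lra.
Qed.

(** Bernoulli's inequality bounds the expression below by [1 - (2 * u) ^+ n], and [2 * u < 1]. *)
Lemma step_poly_cvg1 u : 0 <= u < 2^-1 ->
  (fun n => (1 - u ^+ n) ^+ (2 ^ n)) @ \oo --> (1 : R).
Proof.
move=> /andP[u0 u2].
apply: (@squeeze_cvgr _ _ _ _ (fun n => 1 - (2 * u) ^+ n) (fun=> 1)).
- near=> n; have un1 : u ^+ n <= 1 by rewrite exprn_ile1//; lra.
  have u01 : 0 <= u <= 1 by apply/andP; split; lra.
  have /andP[_ ->] := step_poly_bounds _ n u01.
  rewrite andbT; have := @bernoulli_ineq (- u ^+ n) (2 ^ n).
  by rewrite natrX mulrN -exprMn; apply; rewrite lerN2.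
- rewrite -[X in _ --> X]subr0; apply: cvgB; first exact: cvg_cst.
  by apply: cvg_expr; rewrite ger0_norm; lra.
- exact: cvg_cst.
Unshelve. all: by end_near. Qed.

(** By Bernoulli [(2 * u) ^+ n <= (1 + u ^+ n) ^+ (2 ^ n)], while the product of this power with the
    expression is at most 1. So the expression is at most [(2 * u)^-1 ^+ n]. *)
Lemma step_poly_cvg0 u : 2^-1 < u <= 1 ->
  (fun n => (1 - u ^+ n) ^+ (2 ^ n)) @ \oo --> (0 : R).
Proof.
move=> /andP[u2 u1]; have u0 : 0 < u by lra.
apply: (@squeeze_cvgr _ _ _ _ (fun=> 0) (fun n => (2 * u)^-1 ^+ n)).
- near=> n; have un1 : u ^+ n <= 1 by rewrite exprn_ile1//; lra.
  have un0 : 0 <= u ^+ n by rewrite exprn_ge0//; lra.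
  have u01 : 0 <= u <= 1 by apply/andP; split; lra.
  have /andP[-> _] /= := step_poly_bounds _ n u01.
  rewrite exprVn -[leRHS]mul1r ler_pdivlMr ?exprn_gt0 ?mulr_gt0//.
  apply: (@le_trans _ _ ((1 - u ^+ n) ^+ (2 ^ n) * (1 + u ^+ n) ^+ (2 ^ n))).
    rewrite ler_wpM2l ?exprn_ge0 ?subr_ge0//.
    have := @bernoulli_ineq (u ^+ n) (2 ^ n); rewrite natrX -exprMn => /(_ _) H.
    by rewrite (le_trans _ (H _)) ?lerDr//; lra.
  rewrite -exprMn exprn_ile1//; nra.
- exact: cvg_cst.
- apply: cvg_expr; rewrite ger0_norm ?invr_ge0 ?invf_lt1; lra.
Unshelve. all: by end_near. Qed.

End StepPolynomials.

(** * Trigonometric polynomials and their closure in L^2 *)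

Section Trigonometric.
Context {R : realType}.
Implicit Types f g h S T : R -> R.
Notation mu := (@lebesgue_measure R).
Notation D := (@Ipi R).

(* The phase [th] accounts for the sines. *)
Inductive trigpoly : (R -> R) -> Prop :=
| trigpoly0 : trigpoly (fun=> 0)
| trigpoly_cons c (m : int) th T : trigpoly T ->
    trigpoly (fun x => c * cos (m%:~R * x + th) + T x).

Lemma all_moments_cos (m : int) th : all_moments (fun x : R => cos (m%:~R * x + th)).
Proof.
apply: (@all_moments_bounded _ _ 1) => [|x _]; last exact: cos_max.
apply: measurableT_comp; first exact: continuous_measurable_fun (@continuous_cos R).
by apply: measurable_funD => //; apply: measurable_funM.
Qed.

Lemma trigpoly_moments T : trigpoly T -> all_moments T.
Proof.
elim=> [|c m th {}T _ IH]; first exact: all_moments_cst.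
by apply: all_momentsD => //; apply: all_momentsZ; exact: all_moments_cos.
Qed.

Lemma trigpolyD S T : trigpoly S -> trigpoly T -> trigpoly (fun x => S x + T x).
Proof.
move=> tS tT; elim: tS => [|c m th S' _ IH].
  by under [fun x => _]eq_fun do rewrite add0r.
under [fun x => _]eq_fun do rewrite -addrA.
exact: trigpoly_cons.
Qed.

Lemma trigpoly_cos c (m : int) th : trigpoly (fun x => c * cos (m%:~R * x + th)).
Proof.
under [fun x => _]eq_fun do rewrite -[_ * _]addr0.
by apply: trigpoly_cons; exact: trigpoly0.
Qed.

Lemma trigpoly_cst c : trigpoly (fun=> c).
Proof.
have := trigpoly_cos c 0 0.
by under [fun x => _]eq_fun do rewrite mul0r addr0 cos0 mulr1.
Qed.

(** Product-to-sum formulas keep the frequencies integral and only add or subtract the phases. *)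
Lemma trigpolyM S T : trigpoly S -> trigpoly T -> trigpoly (fun x => S x * T x).
Proof.
move=> tS tT; elim: tS => [|c m th S' _ IH].
  by under [fun x => _]eq_fun do rewrite mul0r; exact: trigpoly0.
under [fun x => _]eq_fun do rewrite mulrDl.
apply: trigpolyD => // {IH}.
elim: tT => [|d k ph T' _ IH].
  by under [fun x => _]eq_fun do rewrite mulr0; exact: trigpoly0.
have E x : c * cos (m%:~R * x + th) * (d * cos (k%:~R * x + ph) + T' x) =
   (c * d / 2) * cos ((m + k)%:~R * x + (th + ph)) +
   ((c * d / 2) * cos ((m - k)%:~R * x + (th - ph)) +
    c * cos (m%:~R * x + th) * T' x).
  have -> : (m + k)%:~R * x + (th + ph) = (m%:~R * x + th) + (k%:~R * x + ph).
    by rewrite intrD; ring.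
  have -> : (m - k)%:~R * x + (th - ph) = (m%:~R * x + th) - (k%:~R * x + ph).
    by rewrite intrB; ring.
  set a := m%:~R * x + th; set b := k%:~R * x + ph.
  by rewrite (cosD a) (cosB a); field.
under [fun x => _]eq_fun do rewrite E.
by do 2 apply: trigpoly_cons.
Qed.

Lemma trigpolyZ c T : trigpoly T -> trigpoly (fun x => c * T x).
Proof. by move=> ?; apply: trigpolyM => //; exact: trigpoly_cst. Qed.

Lemma trigpolyX n T : trigpoly T -> trigpoly (fun x => T x ^+ n).
Proof.
move=> tT; elim: n => [|n IH]; first exact: trigpoly_cst.
by under [fun x => _]eq_fun do rewrite exprS; exact: trigpolyM.
Qed.

Definition trig_approx f : Prop := all_moments f /\
  forall e, 0 < e -> exists2 T, trigpoly T & intpi (fun x => (f x - T x) ^+ 2) < e.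

Lemma all_moments_sqrB f T : all_moments f -> trigpoly T ->
  all_moments (fun x => (f x - T x) ^+ 2).
Proof.
by move=> Lf tT; apply/all_momentsX/all_momentsB => //; exact: trigpoly_moments.
Qed.

Lemma trig_approx_trig T : trigpoly T -> trig_approx T.
Proof.
move=> tT; split=> [|e e0]; first exact: trigpoly_moments.
exists T => //; under [fun x => _]eq_fun do rewrite subrr expr0n.
by rewrite /intpi Rintegral_cst ?mul0r//; exact: measurable_Ipi.
Qed.

Lemma trig_approxD f g : trig_approx f -> trig_approx g ->
  trig_approx (fun x => f x + g x).
Proof.
move=> [Lf fa] [Lg ga]; split=> [|e e0]; first exact: all_momentsD.
(* The square of a sum is at most twice the sum of the squares, so two errors below [e / 4]
   suffice. *)
have e4 : 0 < e / 4 by lra.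
have [S tS Se] := fa _ e4; have [T tT Te] := ga _ e4.
exists (fun x => S x + T x); first exact: trigpolyD.
have LS := all_moments_sqrB _ _ Lf tS; have LT := all_moments_sqrB _ _ Lg tT.
apply: (@le_lt_trans _ _ (intpi (fun x => 2 * (f x - S x) ^+ 2 + 2 * (g x - T x) ^+ 2))).
  apply: le_intpi.
  - by apply: all_moments_sqrB; [exact: all_momentsD | exact: trigpolyD].
  - by apply: all_momentsD; exact: all_momentsZ.
  - move=> x _; set a := f x; set b := S x; set c := g x; set d := T x.
    by have := sqr_ge0 (a - b - (c - d)); rewrite !expr2; lra.
by rewrite intpiD ?intpiZ//; [lra | exact: all_momentsZ..].
Qed.

Lemma trig_approxZ c f : trig_approx f -> trig_approx (fun x => c * f x).
Proof.
move=> [Lf fa]; split=> [|e e0]; first exact: all_momentsZ.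
have e1 : 0 < e / (c ^+ 2 + 1) by rewrite divr_gt0// ltr_wpDl ?sqr_ge0.
have [S tS Se] := fa _ e1.
exists (fun x => c * S x); first exact: trigpolyZ.
have LS := all_moments_sqrB _ _ Lf tS.
under [fun x => _]eq_fun do rewrite -mulrBr exprMn.
rewrite intpiZ//; move: Se; rewrite ltr_pdivlMr ?ltr_wpDl ?sqr_ge0//.
have := @intpi_ge0 R (fun x => (f x - S x) ^+ 2) (fun x _ => sqr_ge0 _).
set I := intpi _; have := sqr_ge0 c; set c2 := c ^+ 2; nra.
Qed.

Lemma trig_approx_sum (J : Type) (s : seq J) (F : J -> R -> R) :
  (forall j, trig_approx (F j)) -> trig_approx (fun x => \sum_(j <- s) F j x).
Proof.
move=> LF; elim: s => [|j s IH].
  under [fun x => _]eq_fun do rewrite big_nil.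
  exact/trig_approx_trig/trigpoly0.
under [fun x => _]eq_fun do rewrite big_cons; exact: trig_approxD.
Qed.

(** The squares [(f - f_ n) ^+ 2] are dominated by [4 * g ^+ 2], so convergence also holds in L^2;
    then some [f_ n] is approximated in turn. *)
Lemma trig_approx_lim (f_ : nat -> R -> R) f g :
  (forall n, trig_approx (f_ n)) -> all_moments f -> all_moments g ->
  (forall n x, D x -> `|f_ n x| <= g x) -> (forall x, D x -> `|f x| <= g x) ->
  {ae mu, forall x, D x -> f_ ^~ x @ \oo --> f x} -> trig_approx f.
Proof.
move=> fa Lf Lg fng fg cf; split=> // e e0.
have Lsq n : all_moments (fun x => (f x - f_ n x) ^+ 2).
  by apply/all_momentsX/all_momentsB => //; have [] := fa n.
have c0 : (fun n => intpi (fun x => (f x - f_ n x) ^+ 2)) @ \oo --> 0.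
  apply: (@intpi_cvg0 _ _ (fun x => 4 * g x ^+ 2)).
  - by move=> n; have [] := Lsq n.
  - apply: negligibleS cf => x /=; apply: contra_not => cf Dx.
    rewrite [X in _ --> X](_ : 0 = (f x - f x) ^+ 2); last by rewrite subrr expr0n.
    rewrite expr2; under [fun n => _]eq_fun do rewrite expr2.
    by apply: cvgM; apply: cvgB (cf Dx); exact: cvg_cst.
  - by apply: all_moments_integrable; apply/all_momentsZ/all_momentsX.
  - move=> n x Dx; rewrite ger0_norm ?sqr_ge0//.
    rewrite (_ : 4 * g x ^+ 2 = (2 * g x) ^+ 2); last by rewrite exprMn; congr (_ * _); ring.
    rewrite -[leLHS]real_normK ?num_real//.
    apply: lerXn2r; rewrite ?nnegrE//.
      by rewrite mulr_ge0// (le_trans _ (fg _ Dx)).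
    rewrite (le_trans (ler_normB _ _))// mulr2n mulrDl !mul1r.
    by rewrite lerD ?fg ?fng.
have e4 : 0 < e / 4 by lra.
have [n] : exists n, intpi (fun x => (f x - f_ n x) ^+ 2) < e / 4.
  move/cvgr_lt : c0 => /(_ _ e4) [n _ /(_ n)] H; exists n.
  by apply: H => /=.
move=> fne; have [_ /(_ _ e4) [T tT Te]] := fa n.
exists T => //.
have LT := all_moments_sqrB _ _ (fa n).1 tT.
apply: (@le_lt_trans _ _ (intpi (fun x => 2 * (f x - f_ n x) ^+ 2 + 2 * (f_ n x - T x) ^+ 2))).
  apply: le_intpi.
  - exact: all_moments_sqrB.
  - by apply: all_momentsD; exact: all_momentsZ.
  - move=> x _; set a := f x; set b := f_ n x; set c := T x.
    by have := sqr_ge0 (a - b - (b - c)); rewrite !expr2; lra.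
by rewrite intpiD ?intpiZ//; [lra | exact: all_momentsZ..].
Qed.

End Trigonometric.

(** * From half-lines to Borel sets to nonnegative functions *)

Section Density.
Context {R : realType}.
Implicit Types f g h S T : R -> R.
Implicit Types A : set R.
Notation mu := (@lebesgue_measure R).
Notation D := (@Ipi R).

Lemma all_moments_indic A : measurable A -> all_moments (\1_A : R -> R).
Proof.
move=> mA; apply: (@all_moments_bounded _ _ 1) => [|x _].
  by apply: measurable_funTS; exact: measurable_indic.
by rewrite indicE; case: (_ \in _); rewrite ?normr1 ?normr0.
Qed.

Lemma indic_norm_le1 A x : `|\1_A x : R| <= 1.
Proof. by rewrite indicE; case: (_ \in _); rewrite ?normr1 ?normr0. Qed.

Lemma sin_half_neg (t : R) : - pi < t < 0 -> sin t < 0.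
Proof.
move=> /andP[t1 t2]; rewrite -[t]opprK sinN oppr_lt0 sin_gt0_pi//.
by apply/andP; split; lra.
Qed.

(* By the product formula [u x = (1 + sin ((x + pi) / 2) * sin ((x - b) / 2)) / 2],
   which on the circle crosses the level 1/2 only at [b] and at [pi]. *)
Lemma trig_approx_ray_inner b : - pi <= b <= pi -> trig_approx (\1_(`]-oo, b[) : R -> R).
Proof.
move=> /andP[b1 b2].
pose u x : R := 2^-1 + (cos ((b + pi) / 2) - cos (x + (pi - b) / 2)) / 4.
have u01 x : 0 <= u x <= 1.
  have := cos_le1 ((b + pi) / 2); have := cos_geN1 ((b + pi) / 2).
  have := cos_le1 (x + (pi - b) / 2); have := cos_geN1 (x + (pi - b) / 2).
  by rewrite /u => *; apply/andP; split; lra.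
have uE x : u x = 2^-1 + sin ((x + pi) / 2) * sin ((x - b) / 2) / 2.
  rewrite /u; set s := (x + pi) / 2; set t := (x - b) / 2.
  have -> : (b + pi) / 2 = s - t by rewrite /s /t; field.
  have -> : x + (pi - b) / 2 = s + t by rewrite /s /t; field.
  by rewrite cosB cosD; field.
have tu : trigpoly u.
  have -> : u = fun x => (- 4^-1) * cos (1%:~R * x + (pi - b) / 2) +
                         (2^-1 + cos ((b + pi) / 2) / 4).
    by apply/funext => x; rewrite /u mul1r; field.
  by apply: trigpoly_cons; exact: trigpoly_cst.
apply: (@trig_approx_lim _ (fun n x => (1 - u x ^+ n) ^+ (2 ^ n)) _ (fun=> 1)).
- move=> n; apply: trig_approx_trig; apply: trigpolyX.
  apply: trigpolyD; first exact: trigpoly_cst.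
  under [fun x => _]eq_fun do rewrite -mulN1r.
  by apply: trigpolyZ; exact: trigpolyX.
- by apply: all_moments_indic; exact: measurable_itv.
- exact: all_moments_cst.
- move=> n x Dx; have /andP[h1 h2] := step_poly_bounds _ n (u01 x).
  by rewrite ger0_norm.
- by move=> x _; exact: indic_norm_le1.
(* At these three points [u x = 1/2], where the step polynomials tend to neither 0 nor 1. *)
- exists ([set - pi] `|` [set b] `|` [set pi]); split.
  + by do 2 (apply: measurableU => //).
  + apply/countable_lebesgue_measure0/finite_set_countable.
    by rewrite !finite_setU; do ?split; exact: finite_set1.
  move=> x /=; apply: contra_notP => /not_orP[/not_orP[/eqP x1 /eqP x2] /eqP x3].
  rewrite /Ipi /= in_itv /= => /andP[xl xr].
  have {x1} {}xl : - pi < x by rewrite lt_neqAle eq_sym x1.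
  have {x3} {}xr : x < pi by rewrite lt_neqAle x3.
  have s0 : 0 < sin ((x + pi) / 2).
    by apply: sin_gt0_pi; apply/andP; split; lra.
  have pi0 := @pi_gt0 R.
  have := u01 x; rewrite uE => /andP[ul ur].
  rewrite indicE; move: x2; rewrite neq_lt => /orP[xb|bx].
  + rewrite mem_set /=; last by rewrite in_itv.
    apply: step_poly_cvg1; rewrite ul /=.
    have : sin ((x - b) / 2) < 0 by apply: sin_half_neg; apply/andP; split; lra.
    by move=> t0; nra.
  + rewrite memNset /=; last by rewrite in_itv /= => /(lt_trans bx); rewrite ltxx.
    apply: step_poly_cvg0; rewrite ur andbT.
    have : 0 < sin ((x - b) / 2) by apply: sin_gt0_pi; apply/andP; split; lra.
    by move=> t0; nra.
Qed.

Lemma eq_trig_approx f g : (forall x, D x -> f x = g x) -> all_moments g ->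
  trig_approx f -> trig_approx g.
Proof.
move=> fg Lg [_ fa]; split=> // e /fa[T tT Te]; exists T => //.
by rewrite (@eq_intpi _ _ (fun x => (f x - T x) ^+ 2))// => x Dx; rewrite fg.
Qed.

Lemma trig_approx_ray b : trig_approx (\1_(`]-oo, b[) : R -> R).
Proof.
have mb : all_moments (\1_(`]-oo, b[) : R -> R).
  by apply: all_moments_indic; exact: measurable_itv.
have [bl|bl] := ltP b (- pi).
  apply: (@eq_trig_approx (fun=> 0)) => //.
    move=> x; rewrite /Ipi /= in_itv /= => /andP[xl xr].
    by rewrite indicE memNset//= in_itv/= => xb; lra.
  exact/trig_approx_trig/trigpoly_cst.
have [br|br] := leP b pi; first by apply: trig_approx_ray_inner; rewrite bl br.
apply: (@eq_trig_approx (fun=> 1)) => //.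
  move=> x; rewrite /Ipi /= in_itv /= => /andP[xl xr].
  by rewrite indicE mem_set//= in_itv/=; lra.
exact/trig_approx_trig/trigpoly_cst.
Qed.

Lemma indic_trivIset_sum (F : nat -> set R) n x : trivIset [set: nat] F ->
  \sum_(k < n) (\1_(F k) x : R) = \1_(\bigcup_(k < n) F k) x.
Proof.
move=> tF; rewrite [RHS]indicE.
have [/set_mem [k /= kn Fkx]|nF] := boolP (x \in _).
  rewrite (bigD1 (Ordinal kn))//= indicE mem_set//= big1 ?addr0// => j jk.
  rewrite indicE memNset// => Fjx.
  move/eqP : jk; apply; apply: val_inj => /=.
  by apply: tF => //; exists x.
rewrite big1// => k _; rewrite indicE memNset// => Fk; move/negP: nF; apply.
by rewrite mem_set//; exists k => /=.
Qed.

(** Dynkin's pi-lambda theorem: open left rays are stable under intersection and generate the Borel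
    sets. Complements are handled by linearity, disjoint unions by dominated limits. *)
Lemma trig_approx_indic A : measurable A -> trig_approx (\1_A : R -> R).
Proof.
move=> mA.
pose G := @RGenInftyO.G R.
have GE : @measurable _ R = <<s G >> := RGenInftyO.measurableE R.
apply: (@dynkin_induction _ R G (fun A => trig_approx (\1_A : R -> R))) => //.
- move=> _ _ [x ->] [y ->]; exists (Num.min x y); apply/seteqP; split=> z /=.
    by rewrite !in_itv/= lt_min => -[-> ->].
  by rewrite !in_itv/= lt_min => /andP[-> ->].
- rewrite indicT; exact/trig_approx_trig/trigpoly_cst.
- move=> _ [x ->]; exact: trig_approx_ray.
- move=> S mS aS.
  have -> : \1_(~` S) = (fun x => 1 + (-1) * \1_S x) :> (R -> R).
    apply/funext => x; rewrite indicC indicE; case: (x \in S) => /=.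
      by rewrite mulr1 subrr.
    by rewrite mulr0 addr0.
  apply: trig_approxD; first exact/trig_approx_trig/trigpoly_cst.
  exact: trig_approxZ.
- move=> F mF tF aF.
  apply: (@trig_approx_lim _ (fun n x => \sum_(k < n) \1_(F k) x) _ (fun=> 1)).
  + move=> n; exact: trig_approx_sum.
  + by apply: all_moments_indic; exact: bigcup_measurable.
  + exact: all_moments_cst.
  + by move=> n x _; rewrite indic_trivIset_sum//; exact: indic_norm_le1.
  + by move=> x _; exact: indic_norm_le1.
  + apply: aeW => x _; apply: cvg_near_cst.
    have [[k _ Fkx]|nF] := pselect ((\bigcup_k F k) x).
      exists k.+1 => // n /= kn; apply/eqP.
      by rewrite indic_trivIset_sum// !indicE !mem_set//; exists k.
    apply: nearW => n; rewrite indic_trivIset_sum// !indicE !memNset// => -[k _ Fk].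
    by apply: nF; exists k.
- by rewrite -GE.
Qed.

Import HBNNSimple.

(** [f] is the increasing limit of simple functions and itself dominates them. *)
Lemma trig_approx_ge0 f : all_moments f -> (forall x, D x -> 0 <= f x) ->
  trig_approx f.
Proof.
move=> Lf f0; have mf : measurable_fun D (EFin \o f).
  by apply/measurable_EFinP; have [] := Lf.
pose f_ := nnsfun_approx measurable_Ipi mf.
have f0' x : D x -> (0 <= (EFin \o f) x)%E by move=> Dx; rewrite lee_fin f0.
apply: (@trig_approx_lim _ f_ _ f) => //.
- move=> n.
  have /funext -> := fimfunEord (f_ n).
  apply: trig_approx_sum => i; apply: trig_approxZ; apply: trig_approx_indic.
  exact: measurable_funPTI.
- move=> n x Dx; rewrite ger0_norm//.
  by rewrite -lee_fin /f_ nnsfun_approxE; exact: (@le_approx _ _ _ _ _ _ _ f0').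
- by move=> x Dx; rewrite ger0_norm// f0.
- apply: aeW => x Dx.
  have := @cvg_nnsfun_approx _ _ _ _ measurable_Ipi _ mf f0' x Dx.
  by move/fine_cvg.
Qed.

End Density.

(** * Parseval's formula *)

Section BoxSums.
Context {R : realType}.
Implicit Types F G : int -> R.

(** Symmetric partial sum over the integers from [-M] to [M], shifted by [M] to be indexed by
    ordinals. *)
Definition box_sum F M : R := \sum_(j < M.*2.+1) F (j%:Z - M%:Z).

Lemma box_sum0 F : box_sum F 0 = F 0.
Proof. by rewrite /box_sum big_ord1 subrr. Qed.

Lemma box_sumS F M : box_sum F M.+1 = F (- M.+1%:Z) + box_sum F M + F M.+1%:Z.
Proof.
rewrite /box_sum doubleS big_ord_recl big_ord_recr /= addrA; congr (F _ + _ + F _).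
- by lia.
- by apply: eq_bigr => j _; congr F; rewrite /bump; lia.
- by rewrite /bump; lia.
Qed.

Lemma eq_box_sum F G M : F =1 G -> box_sum F M = box_sum G M.
Proof. by move=> FG; apply: eq_bigr => j _. Qed.

Lemma le_box_sum F G M : (forall j, F j <= G j) -> box_sum F M <= box_sum G M.
Proof. by move=> FG; apply: ler_sum => j _. Qed.

Lemma box_sum_ge0 F M : (forall j, 0 <= F j) -> 0 <= box_sum F M.
Proof. by move=> F0; apply: sumr_ge0 => j _. Qed.

Lemma box_sumZ c F M : box_sum (fun j => c * F j) M = c * box_sum F M.
Proof. by rewrite /box_sum mulr_sumr. Qed.

Lemma box_sumD F G M : box_sum (fun j => F j + G j) M = box_sum F M + box_sum G M.
Proof. by rewrite /box_sum big_split. Qed.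

Lemma box_sumN F M : box_sum (fun j => F (- j)) M = box_sum F M.
Proof.
elim: M => [|M IH]; first by rewrite !box_sum0 oppr0.
by rewrite !box_sumS IH opprK addrC addrA [F (- _) + _]addrC addrAC [F _ + _]addrC.
Qed.

Lemma box_sum_trunc F M L : (M <= L)%N ->
  box_sum (fun j => if (`|j| <= M)%N then F j else 0) L = box_sum F M.
Proof.
move=> ML; rewrite -(subnK ML); elim: (L - M)%N => [|d IH].
  rewrite add0n; apply: eq_bigr => j _; case: ifP => //; have := ltn_ord j; lia.
by rewrite addSn box_sumS IH !ifF ?add0r ?addr0//; lia.
Qed.

Lemma box_sum_delta F m M :
  box_sum (fun j => if j == m then F j else 0) M = if (`|m| <= M)%N then F m else 0.
Proof.
elim: M => [|M IH].
  rewrite box_sum0 eq_sym; have -> : (`|m| <= 0)%N = (m == 0) by lia.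
  by case: eqP => [->|].
rewrite box_sumS IH.
have [<-|m1] := eqVneq (- M.+1%:Z) m.
  have -> : (`|- M.+1%:Z| <= M)%N = false by lia.
  have -> : (`|- M.+1%:Z| <= M.+1)%N by lia.
  have -> : (M.+1%:Z == - M.+1%:Z) = false by lia.
  by rewrite !addr0.
have [<-|m2] := eqVneq (M.+1%:Z) m.
  have -> : (`|M.+1%:Z| <= M)%N = false by lia.
  have -> : (`|M.+1%:Z| <= M.+1)%N by lia.
  by rewrite !add0r.
rewrite add0r addr0; have -> // : (`|m| <= M.+1)%N = (`|m| <= M)%N.
by lia.
Qed.

Lemma box_sum_mono F M L : (forall j, 0 <= F j) -> (M <= L)%N ->
  box_sum F M <= box_sum F L.
Proof.
move=> F0 ML; rewrite -(box_sum_trunc F _ _ ML); apply: le_box_sum => j.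
by case: ifP.
Qed.

End BoxSums.

(** * Integrals of cosines over a period *)

Section Fourier.
Context {R : realType}.
Implicit Types f g h S T : R -> R.
Notation mu := (@lebesgue_measure R).
Notation D := (@Ipi R).

Lemma sin_natpi n : sin (n%:R * pi) = 0 :> R.
Proof.
elim: n => [|n IH]; first by rewrite mul0r sin0.
by rewrite -natr1 mulrDl mul1r sinD IH sinpi mul0r mulr0 addr0.
Qed.

Lemma sin_intpi (m : int) : sin (m%:~R * pi) = 0 :> R.
Proof.
by case: m => n; rewrite ?NegzE ?mulrNz ?mulNr ?sinN ?[n%:~R]pmulrn sin_natpi ?oppr0.
Qed.

(** For [m != 0] a primitive is [sin (m x + th) / m], whose increment over the interval is a
    multiple of [sin (m pi) = 0]. *)
Lemma intpi_cos (m : int) th :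
  intpi (fun x : R => cos (m%:~R * x + th)) = if m == 0 then 2 * pi * cos th else 0.
Proof.
have pi0 := @pi_gt0 R.
case: eqP => [->|/eqP m0].
  rewrite (@eq_intpi _ _ (fun=> cos th)); last by move=> x _; rewrite mul0r add0r.
  rewrite /intpi Rintegral_cst; last exact: measurable_Ipi.
  by rewrite mulrC; have /= -> := congr1 fine (@measure_Ipi R).
have mR : (m%:~R : R) != 0 by rewrite intr_eq0.
pose F x : R := (m%:~R)^-1 * sin (m%:~R * x + th).
have dF (x : R) : is_derive x 1 F (cos (m%:~R * x + th)).
  apply: is_derive_eq; rewrite !(scaler0, addr0, add0r, mulr1) /GRing.scale /=.
  by rewrite !mulr1 mulrCA mulVf// mulr1.
have cF : continuous F.
  by move=> x; apply/differentiable_continuous/derivable1_diffP; have [] := dF x.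
rewrite /intpi /Rintegral /Ipi (@continuous_FTC2 _ _ F); last first.
- by move=> x _; rewrite derive1E; apply: derive_val.
- split=> [x _| |]; first by have [] := dF x.
  + by apply: cvg_at_right_filter; exact: cF.
  + by apply: cvg_at_left_filter; exact: cF.
- apply: continuous_subspaceT => x.
  apply: continuous_comp; last exact: continuous_cos.
  by apply: cvgD; [apply: cvgM => //; exact: cvg_cst|exact: cvg_cst].
- by lra.
rewrite /= /F mulrN !sinD sinN cosN !sin_intpi; ring.
Qed.

End Fourier.

(** * Fourier partial sums and their convergence in L^2 *)

Section Parseval.
Context {R : realType}.
Implicit Types f g h S T : R -> R.
Notation D := (@Ipi R).

Lemma all_moments_cosM (m : int) : all_moments (fun x : R => cos (m%:~R * x)).
Proof.
have := @all_moments_cos R m 0.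
by under [fun x => _]eq_fun do rewrite addr0.
Qed.

Lemma all_moments_sinM (m : int) : all_moments (fun x : R => sin (m%:~R * x)).
Proof.
have := @all_moments_cos R m (- (pi / 2)).
by under [fun x => _]eq_fun do rewrite cosBpihalf.
Qed.

Definition cos_coef f (m : int) : R := intpi (fun x => cos (m%:~R * x) * f x).

Lemma cos_coefN f m : cos_coef f (- m) = cos_coef f m.
Proof. by apply: eq_intpi => x _; rewrite mulrNz mulNr cosN. Qed.

(** For a function whose sine coefficients vanish, this is the symmetric partial sum of its Fourier
    series. *)
Definition cos_partial_sum f M x : R :=
  (2 * pi)^-1 * box_sum (fun j => cos_coef f j * cos (j%:~R * x)) M.

Lemma all_moments_partial_sum f M : all_moments (cos_partial_sum f M).
Proof.
apply: all_momentsZ; apply: all_moments_sum => j; apply: all_momentsZ.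
exact: all_moments_cosM.
Qed.

Context {p : R -> R}.
Hypothesis Lp : all_moments p.
Hypothesis sin_coef0 : forall m : int, intpi (fun x => sin (m%:~R * x) * p x) = 0.

Lemma intpi_coef (m : int) th :
  intpi (fun x => p x * cos (m%:~R * x + th)) = cos th * cos_coef p m.
Proof.
rewrite (@eq_intpi _ _ (fun x => cos th * (cos (m%:~R * x) * p x) -
   sin th * (sin (m%:~R * x) * p x))); last first.
  by move=> x _; rewrite cosD; ring.
have Lc := all_momentsM _ _ (all_moments_cosM m) Lp.
have Ls := all_momentsM _ _ (all_moments_sinM m) Lp.
by rewrite intpiB ?intpiZ ?sin_coef0 ?mulr0 ?subr0//; exact: all_momentsZ.
Qed.

(** After the product-to-sum formula only [j = m] and [j = -m] survive, each contributing one half;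
    for [m = 0] both halves come from the same index. *)
Lemma intpi_partial_sum (m : int) th M : (`|m| <= M)%N ->
  intpi (fun x => cos_partial_sum p M x * cos (m%:~R * x + th)) = cos th * cos_coef p m.
Proof.
move=> mM; have pi0 := @pi_gt0 R.
pose c j x := (4 * pi)^-1 * cos_coef p j * cos ((j + m)%:~R * x + th) +
  (4 * pi)^-1 * cos_coef p j * cos ((j - m)%:~R * x - th).
rewrite (@eq_intpi _ _ (fun x => box_sum (c ^~ x) M)); last first.
  move=> x _; rewrite /cos_partial_sum /box_sum mulr_sumr mulr_suml.
  apply: eq_bigr => j _; set k := _ - _; rewrite /c.
  have -> : (k + m)%:~R * x + th = k%:~R * x + (m%:~R * x + th) by rewrite intrD; ring.
  have -> : (k - m)%:~R * x - th = k%:~R * x - (m%:~R * x + th) by rewrite intrB; ring.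
  by set a := k%:~R * x; rewrite (cosD a) (cosB a); field; lra.
have Lc1 j (k : int) t : all_moments (fun x => (4 * pi)^-1 * cos_coef p j * cos (k%:~R * x + t)).
  by apply: all_momentsZ; exact: all_moments_cos.
rewrite intpi_sum; last by move=> j; exact: all_momentsD.
transitivity (box_sum (fun j =>
   (if j == - m then (cos th / 2) * cos_coef p j else 0) +
   (if j == m then (cos th / 2) * cos_coef p j else 0)) M).
  apply: eq_bigr => j _; rewrite intpiD// !intpiZ; try exact: all_moments_cos.
  rewrite !intpi_cos cosN addr_eq0 subr_eq0.
  by congr (_ + _); case: ifP => _; rewrite ?mulr0//; field; lra.
rewrite box_sumD !box_sum_delta abszN mM cos_coefN; lra.
Qed.

Lemma intpi_sub_partial_sum (m : int) th M : (`|m| <= M)%N ->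
  intpi (fun x => (p x - cos_partial_sum p M x) * cos (m%:~R * x + th)) = 0.
Proof.
move=> mM; under [fun x => _]eq_fun do rewrite mulrBl.
rewrite intpiB; first by rewrite intpi_coef intpi_partial_sum// subrr.
- by apply: all_momentsM => //; exact: all_moments_cos.
- by apply: all_momentsM; [exact: all_moments_partial_sum|exact: all_moments_cos].
Qed.

Lemma all_moments_sub_partial_sum M :
  all_moments (fun x => p x - cos_partial_sum p M x).
Proof. by apply: all_momentsB => //; exact: all_moments_partial_sum. Qed.

Lemma sub_partial_sum_orth M :
  intpi (fun x => (p x - cos_partial_sum p M x) * cos_partial_sum p M x) = 0.
Proof.
have Ld := all_moments_sub_partial_sum M.
rewrite (@eq_intpi _ _ (fun x => \sum_(j < M.*2.+1) ((2 * pi)^-1 * cos_coef p (j%:Z - M%:Z)) *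
   ((p x - cos_partial_sum p M x) * cos ((j%:Z - M%:Z)%:~R * x + 0)))); last first.
  move=> x _; rewrite {2}/cos_partial_sum /box_sum mulr_sumr mulr_sumr.
  by apply: eq_bigr => j _; rewrite addr0; ring.
rewrite intpi_sum; last first.
  by move=> j; apply/all_momentsZ/all_momentsM => //; exact: all_moments_cos.
rewrite big1// => j _; rewrite intpiZ; last first.
  by apply: all_momentsM => //; exact: all_moments_cos.
by rewrite intpi_sub_partial_sum ?mulr0//; have := ltn_ord j; lia.
Qed.

(** [M0] is the largest absolute frequency occurring in [T]. *)
Lemma sub_partial_sum_orth_trig T : trigpoly T -> exists M0, forall M, (M0 <= M)%N ->
  intpi (fun x => (p x - cos_partial_sum p M x) * T x) = 0.
Proof.
elim=> [|c m th {}T tT [M0 IH]].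
  exists 0%N => M _; rewrite (@eq_intpi _ _ (fun x => 0 * p x)).
    by rewrite intpiZ// mul0r.
  by move=> x _; rewrite mulr0 mul0r.
exists (maxn `|m| M0) => M; rewrite geq_max => /andP[mM /IH {}IH].
have Ld := all_moments_sub_partial_sum M.
rewrite (@eq_intpi _ _ (fun x => c * ((p x - cos_partial_sum p M x) * cos (m%:~R * x + th)) +
  (p x - cos_partial_sum p M x) * T x)); last by move=> x _; ring.
have Lc := all_momentsM _ _ Ld (all_moments_cos m th).
rewrite intpiD; last 2 first.
- exact: all_momentsZ.
- by apply: all_momentsM => //; exact: trigpoly_moments.
by rewrite intpiZ// intpi_sub_partial_sum// IH mulr0 addr0.
Qed.

Hypothesis p0 : forall x, D x -> 0 <= p x.

(** Partial sums are best approximations: once [M] reaches the frequencies of a trigonometric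
    polynomial [T] close to [p], the partial sum is at least as close. *)
Lemma partial_sum_cvg_L2 e : 0 < e -> exists M0, forall M, (M0 <= M)%N ->
  intpi (fun x => (p x - cos_partial_sum p M x) ^+ 2) < e.
Proof.
move=> e0; have [_ /(_ _ e0)[T tT Te]] := trig_approx_ge0 _ Lp p0.
have [M0 HM] := sub_partial_sum_orth_trig _ tT; exists M0 => M /HM orthT.
have Ld := all_moments_sub_partial_sum M.
have LS := all_moments_partial_sum p M.
have LT := trigpoly_moments _ tT.
(* [p - S] is orthogonal to [S - T], where [S] is the partial sum *)
apply: le_lt_trans Te.
have Ldd := all_momentsM _ _ Ld Ld.
have LdS := all_momentsM _ _ Ld LS; have LdT := all_momentsM _ _ Ld LT.
apply: (@le_trans _ _ (intpi (fun x => (p x - cos_partial_sum p M x) ^+ 2 +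
   (2 * ((p x - cos_partial_sum p M x) * cos_partial_sum p M x) +
    (-2) * ((p x - cos_partial_sum p M x) * T x))))).
  rewrite intpiD; last 2 first.
  - exact: all_momentsX.
  - by apply: all_momentsD; exact: all_momentsZ.
  rewrite intpiD; try exact: all_momentsZ.
  by rewrite !intpiZ// orthT sub_partial_sum_orth !mulr0 !addr0.
apply: le_intpi.
- by apply: all_momentsD; [exact: all_momentsX | apply: all_momentsD; exact: all_momentsZ].
- exact: all_moments_sqrB.
- move=> x _; set a := p x; set b := cos_partial_sum p M x; set c := T x.
  have := sqr_ge0 (b - c); rewrite !expr2; lra.
Qed.

(** The box sum is [2 * pi] times the inner product of [g] with the partial sum of [p], so only the
    Fourier series of [p] has to converge in L^2. *)
Lemma parseval_cvg g : all_moments g ->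
  box_sum (fun j => cos_coef p j * cos_coef g j) @ \oo -->
  2 * pi * intpi (fun x => p x * g x).
Proof.
move=> Lg; have pi0 := @pi_gt0 R.
have sE M : box_sum (fun j => cos_coef p j * cos_coef g j) M =
    2 * pi * intpi (fun x => cos_partial_sum p M x * g x).
  rewrite (@eq_intpi _ _ (fun x => \sum_(j < M.*2.+1) ((2 * pi)^-1 * cos_coef p (j%:Z - M%:Z)) *
     (cos ((j%:Z - M%:Z)%:~R * x) * g x))); last first.
    move=> x _; rewrite /cos_partial_sum /box_sum mulr_sumr mulr_suml.
    by apply: eq_bigr => j _; ring.
  have Lcg (j : int) := all_momentsM _ _ (all_moments_cosM j) Lg.
  rewrite intpi_sum; last by move=> j; exact: all_momentsZ.
  rewrite mulr_sumr; apply: eq_bigr => j _; rewrite intpiZ// -/(cos_coef g _).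
  by field; lra.
rewrite (funext sE).
apply: cvgM; first exact: cvg_cst.
apply/cvgrPdist_lt => e e0.
set G := intpi (fun x => g x ^+ 2).
have G0 : 0 <= G by apply: intpi_ge0 => x _; exact: sqr_ge0.
(* This [t] balances the two terms of the AM-GM bound below; [G + 1] avoids a division by 0, and an
   L^2 error below [e * t] makes each term smaller than [e / 2]. *)
have [t t0 tE] : exists2 t, 0 < t & t * (G + 1) = e.
  exists (e / (G + 1)); first by rewrite divr_gt0// ltr_wpDl.
  by rewrite divfK//; lra.
have [M0 HM] := partial_sum_cvg_L2 _ (mulr_gt0 e0 t0).
exists M0 => // M /= /HM dM.
have Ld := all_moments_sub_partial_sum M.
have Ldg := all_momentsM _ _ Ld Lg.
have LS := all_moments_partial_sum p M.
rewrite -intpiB; try exact: all_momentsM.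
under [fun x => _]eq_fun do rewrite -mulrBl.
(* AM-GM: [|d g| <= t g^2 / 2 + d^2 / (2 t)] *)
have bnd (s : R) : s ^+ 2 = 1 ->
    s * intpi (fun x => (p x - cos_partial_sum p M x) * g x) < e.
  move=> s1; rewrite -intpiZ//.
  apply: (@le_lt_trans _ _ (intpi (fun x => t / 2 * g x ^+ 2 +
      (2 * t)^-1 * (p x - cos_partial_sum p M x) ^+ 2))).
    apply: le_intpi; first exact: all_momentsZ.
      by apply: all_momentsD; apply: all_momentsZ; exact: all_momentsX.
    move=> x _; set d := p x - _.
    rewrite -subr_ge0.
    have -> : t / 2 * g x ^+ 2 + (2 * t)^-1 * d ^+ 2 - s * (d * g x) =
        (2 * t)^-1 * (t * g x - s * d) ^+ 2 + (2 * t)^-1 * (1 - s ^+ 2) * d ^+ 2.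
      by field; lra.
    by rewrite s1 subrr mulr0 mul0r addr0 mulr_ge0 ?sqr_ge0// invr_ge0; lra.
  rewrite intpiD; try by apply: all_momentsZ; exact: all_momentsX.
  rewrite !intpiZ; try exact: all_momentsX.
  rewrite -/G.
  have h1 : t / 2 * G < e / 2 by nra.
  have h2 : (2 * t)^-1 * intpi (fun x => (p x - cos_partial_sum p M x) ^+ 2) < e / 2.
    rewrite mulrC ltr_pdivrMr ?mulr_gt0//.
    by have -> : e / 2 * (2 * t) = e * t by field.
  by lra.
rewrite ltr_norml; apply/andP; split.
  by rewrite ltrNl -mulN1r; apply: bnd; rewrite sqrrN expr1n.
by rewrite -[X in X < _]mul1r; apply: bnd; rewrite expr1n.
Qed.

End Parseval.

(** * Convolution powers of the Fourier coefficients *)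

Section ConvolutionPowers.
Context {R : realType}.
Implicit Types F : int -> R.

Fixpoint conv_pow F M k (m : int) : R :=
  if k is k'.+1 then box_sum (fun j => F j * conv_pow F M k' (m - j)) M
  else (m == 0)%:R.

Lemma conv_pow_ge0 F M k m : (forall j, 0 <= F j) -> 0 <= conv_pow F M k m.
Proof.
move=> F0; elim: k m => [|k IH] m /=; first by rewrite ler0n.
by apply: box_sum_ge0 => j; rewrite mulr_ge0.
Qed.

Lemma conv_pow_trunc F M L k m : (M <= L)%N ->
  conv_pow (fun j => if (`|j| <= M)%N then F j else 0) L k m = conv_pow F M k m.
Proof.
move=> ML; elim: k m => [//|k IH] m /=.
rewrite -[RHS](box_sum_trunc _ _ _ ML); apply: eq_box_sum => j.
by rewrite IH; case: ifP; rewrite ?mul0r.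
Qed.

Context {p : R -> R}.
Hypothesis Lp : all_moments p.
Hypothesis sin_coef0 : forall m : int, intpi (fun x => sin (m%:~R * x) * p x) = 0.
Hypothesis p0 : forall x, Ipi x -> 0 <= p x.
Hypothesis a0 : forall m, 0 <= cos_coef p m.

Let c k m : R := cos_coef (fun x => p x ^+ k) m.

(** Parseval's formula for [p] and [p ^ k * cos (m x)]: multiplying by a further [p] convolves the
    Fourier coefficients. *)
Lemma moment_conv_cvg k m :
  box_sum (fun j => cos_coef p j * c k (m - j)) @ \oo --> 2 * pi * c k.+1 m.
Proof.
have Lk := all_momentsX k _ Lp.
have Lg := all_momentsM _ _ (all_moments_cosM m) Lk.
have := parseval_cvg Lp sin_coef0 p0 _ Lg.
have -> : intpi (fun x => p x * (cos (m%:~R * x) * p x ^+ k)) = c k.+1 m.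
  by apply: eq_intpi => x _; rewrite exprS; ring.
suff -> : box_sum (fun j => cos_coef p j * cos_coef (fun x => cos (m%:~R * x) * p x ^+ k) j)
    = box_sum (fun j => cos_coef p j * c k (m - j)) by [].
(* Averaging over [j] and [-j] produces the two terms of the product-to-sum formula, as [cos_coef p]
   is even. *)
apply/funext => M; transitivity (2^-1 * box_sum (fun j => cos_coef p j * c k (m - j)) M +
   2^-1 * box_sum (fun j => cos_coef p (- j) * c k (m - - j)) M); last first.
  by rewrite (box_sumN (fun j => cos_coef p j * c k (m - j))); lra.
rewrite -!box_sumZ -box_sumD; apply: eq_box_sum => j.
rewrite cos_coefN opprK mulrCA [in X in _ + X]mulrCA -mulrDr; congr (_ * _).
have Lc (i : int) := all_momentsM _ _ (all_moments_cosM i) Lk.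
rewrite /c /cos_coef -!intpiZ// -intpiD; try exact: all_momentsZ.
by apply: eq_intpi => x _; rewrite intrB intrD mulrBl mulrDl cosB cosD; field.
Qed.

Lemma moment_coef0 m : c 0 m = 2 * pi * (m == 0)%:R.
Proof.
rewrite /c /cos_coef (@eq_intpi _ _ (fun x => cos (m%:~R * x + 0))); last first.
  by move=> x _; rewrite addr0 expr0 mulr1.
by rewrite intpi_cos cos0 mulr1; case: eqP; rewrite ?mulr1 ?mulr0.
Qed.

(** By induction [c k.+1] is, up to a positive factor, a limit of sums of nonnegative terms. *)
Lemma moment_coef_ge0 k m : 0 <= c k m.
Proof.
have pi0 := @pi_gt0 R.
elim: k m => [|k IH] m; first by rewrite moment_coef0 !mulr_ge0// ltW.
rewrite -(@pmulr_rge0 _ (2 * pi)); last by lra.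
rewrite -(cvg_lim (@Rhausdorff R) (moment_conv_cvg k m)).
apply: limr_ge; first by apply/cvg_ex; eexists; exact: moment_conv_cvg.
by apply: nearW => M; apply: box_sum_ge0 => j; rewrite mulr_ge0.
Qed.

Lemma moment_conv_le k m M :
  box_sum (fun j => cos_coef p j * c k (m - j)) M <= 2 * pi * c k.+1 m.
Proof.
have cv := moment_conv_cvg k m.
rewrite -(cvg_lim (@Rhausdorff R) cv).
apply: nondecreasing_cvgn_le; last by apply/cvg_ex; eexists; exact: cv.
move=> i j ij; apply: box_sum_mono => // l.
by rewrite mulr_ge0// moment_coef_ge0.
Qed.

Lemma conv_pow_le k m M :
  2 * pi * conv_pow (cos_coef p) M k m <= (2 * pi) ^+ k * c k m.
Proof.
have pi0 := @pi_gt0 R.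
elim: k m => [|k IH] m; first by rewrite expr0 mul1r moment_coef0.
rewrite /= -box_sumZ.
apply: (@le_trans _ _ ((2 * pi) ^+ k * box_sum (fun j => cos_coef p j * c k (m - j)) M)).
  rewrite -box_sumZ; apply: le_box_sum => j; rewrite mulrCA [leRHS]mulrCA.
  by rewrite ler_wpM2l.
rewrite exprSr -[leRHS]mulrA ler_wpM2l ?moment_conv_le// exprn_ge0//; lra.
Qed.

Lemma box_sum_cvg (G : nat -> int -> R) (g : int -> R) L :
  (forall j, G ^~ j @ \oo --> g j) -> (fun M => box_sum (G M) L) @ \oo --> box_sum g L.
Proof.
move=> Gg; elim: L => [|L IH].
  by under eq_fun do rewrite box_sum0; rewrite box_sum0; exact: Gg.
under eq_fun do rewrite box_sumS; rewrite box_sumS.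
by apply: cvgD => //; exact: cvgD.
Qed.

(** Fix an outer window [L] whose sum is within [e / 2] of the target, then let [M] grow inside it.
    By nonnegativity the window [M >= L] only adds to the sum, and [conv_pow_le] bounds it above. *)
Lemma conv_pow_cvg k m :
  (fun M => 2 * pi * conv_pow (cos_coef p) M k m) @ \oo --> (2 * pi) ^+ k * c k m.
Proof.
have pi0 := @pi_gt0 R.
elim: k m => [|k IH] m.
  by rewrite expr0 mul1r moment_coef0 /=; exact: cvg_cst.
apply/cvgrPdist_lt => e e0.
have tgt : (fun L => (2 * pi) ^+ k * box_sum (fun j => cos_coef p j * c k (m - j)) L) @ \oo -->
    (2 * pi) ^+ k.+1 * c k.+1 m.
  rewrite exprSr -[X in _ --> X]mulrA; apply: cvgM; first exact: cvg_cst.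
  exact: moment_conv_cvg.
have e2 : 0 < e / 2 by lra.
move/cvgrPdist_lt : tgt => /(_ _ e2) [L _ /(_ L)] /= /(_ (leqnn _)) hL.
have fx : (fun M => box_sum (fun j => cos_coef p j * (2 * pi * conv_pow (cos_coef p) M k (m - j))) L)
     @ \oo --> box_sum (fun j => cos_coef p j * ((2 * pi) ^+ k * c k (m - j))) L.
  by apply: box_sum_cvg => j; apply: cvgM; [exact: cvg_cst|exact: IH].
move/cvgrPdist_lt : fx => /(_ _ e2) [M0 _ hM0].
exists (maxn L M0) => // M /=; rewrite geq_max => /andP[LM /hM0 /=].
have -> : box_sum (fun j => cos_coef p j * ((2 * pi) ^+ k * c k (m - j))) L =
   (2 * pi) ^+ k * box_sum (fun j => cos_coef p j * c k (m - j)) L.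
  by rewrite -box_sumZ; apply: eq_box_sum => j; rewrite mulrCA.
have -> : box_sum (fun j => cos_coef p j * (2 * pi * conv_pow (cos_coef p) M k (m - j))) L =
   2 * pi * box_sum (fun j => cos_coef p j * conv_pow (cos_coef p) M k (m - j)) L.
  by rewrite -box_sumZ; apply: eq_box_sum => j; rewrite mulrCA.
have := conv_pow_le k.+1 m M.
have /(_ LM) := @box_sum_mono _ (fun j => cos_coef p j * conv_pow (cos_coef p) M k (m - j)) L M
   (fun j => mulr_ge0 (a0 j) (conv_pow_ge0 _ _ _ _ a0)).
rewrite /= -(@ler_pM2l _ (2 * pi)); last by lra.
move: hL; rewrite !ltr_norml => /andP[_ h1] h2 h3 /andP[_ h4].
by apply/andP; split; lra.
Qed.

End ConvolutionPowers.

(** * Convolution powers as sums over tuples *)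

Section ConvPowSum.
Context {R : realType}.
Implicit Types F : int -> R.

Lemma big_ffun_ordS {J : finType} {k} (V : nmodType) (G : {ffun 'I_k.+1 -> J} -> V) :
  \sum_e G e = \sum_j \sum_(e : {ffun 'I_k -> J})
    G [ffun b => if unlift ord0 b is Some b' then e b' else j].
Proof.
rewrite pair_big /=; symmetry.
pose h (u : J * {ffun 'I_k -> J}) : {ffun 'I_k.+1 -> J} :=
  [ffun b => if unlift ord0 b is Some b' then u.2 b' else u.1].
pose h' (e : {ffun 'I_k.+1 -> J}) := (e ord0, [ffun b' => e (lift ord0 b')]).
rewrite [RHS](reindex h) //=; apply: onW_bij; exists h'.
  move=> [j e]; rewrite /h' ffunE unlift_none; congr (_, _).
  by apply/ffunP => b; rewrite !ffunE liftK.
move=> e; apply/ffunP => b; rewrite !ffunE /=.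
by case: unliftP => [b' ->|->]; rewrite ?ffunE.
Qed.

Lemma conv_powE F M k m : conv_pow F M k m =
  \sum_(e : {ffun 'I_k -> 'I_M.*2.+1} | \sum_b ((e b)%:Z - M%:Z) == m)
    \prod_b F ((e b)%:Z - M%:Z).
Proof.
elim: k m => [|k IH] m.
  rewrite big_mkcond (eq_bigr (fun=> (m == 0)%:R)); last first.
    by move=> e _; rewrite !big_ord0 eq_sym; case: eqP.
  by rewrite sumr_const card_ffun !card_ord expn0.
rewrite [RHS]big_mkcond big_ffun_ordS /=; apply: eq_bigr => j _.
rewrite IH mulr_sumr big_mkcond; apply: eq_bigr => e _.
rewrite !big_ord_recl !ffunE unlift_none /=.
rewrite [X in _ + X == m](eq_bigr (fun b => (e b)%:Z - M%:Z)); last first.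
  by move=> b _; rewrite ffunE liftK.
rewrite [X in _ = (if _ then _ * X else _)](eq_bigr (fun b => F ((e b)%:Z - M%:Z))); last first.
  by move=> b _; rewrite ffunE liftK.
by rewrite [_ == m - _]eq_sym subr_eq [m == _]eq_sym addrC.
Qed.

End ConvPowSum.

(** * Dominated convergence *)

Section Assembly.
Context {R : realType} {m : nat}.
Notation n := m.+1.
Context (P : {set {set 'I_n}}) (hP : finset.partition P [set: 'I_n]).
Implicit Types (F : int -> R).

Definition real_K F N : R := N%:R ^ (#|P|%:Z - n%:Z - 1) *
  \sum_(i : {ffun 'I_n -> 'I_N}) \prod_(B in P) F (E_blk B i).

Definition truncate F M (j : int) : R := if (`|j| <= M)%N then F j else 0.

(* A multi-index [e] with values in [0, 2L] encodes the block values [e b - L]. *)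
Definition offset L (e : {ffun 'I_#|P| -> 'I_L.*2.+1}) (B : {set 'I_n}) : int :=
  \sum_(b | enum_val b == B) ((e b)%:Z - L%:Z).

Lemma offsetE L e (b : 'I_#|P|) : @offset L e (enum_val b) = (e b)%:Z - L%:Z.
Proof.
rewrite /offset (big_pred1 b)// => b'.
by rewrite /= (inj_eq enum_val_inj).
Qed.

Lemma sum_offset L e : \sum_(B in P) @offset L e B = \sum_b ((e b)%:Z - L%:Z).
Proof. by rewrite big_enum_val; apply: eq_bigr => b _; rewrite offsetE. Qed.

Definition weight (e : {set 'I_n} -> int) N : R :=
  N%:R ^ (#|P|%:Z - n%:Z - 1) * #|solutions P e N|%:R.

Lemma weight_neq0 e N : \sum_(B in P) e B != 0 -> weight e N = 0.
Proof.
move=> e0; rewrite /weight (_ : solutions P e N = finset.set0) ?cards0 ?mulr0//.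
apply/setP => i; rewrite !inE; apply/negP => /forallP h; case/negP: e0; apply/eqP.
rewrite -[RHS](sum_block_flow P hP (fun j => (i j : nat)%:Z)); apply: eq_bigr => B BP.
by have := h B; rewrite BP => /eqP <-.
Qed.

(** The tree has [r - 1] edges for [r] blocks, so the factor [N ^ #|tree|] of [card_in_box_tree]
    turns [N ^ (r - n - 1)] into the normalisation [N ^ (- n)]. *)
Lemma weight_density e N : \sum_(B in P) e B = 0 -> (0 < N)%N ->
  weight e N = box_density (tree P) (tree_form P) (tree_shift P e) N.
Proof.
move=> e0 N0; have N0' : (N%:R : R) != 0 by rewrite pnatr_eq0 -lt0n.
rewrite /box_density card_in_box_tree// /weight natrM natrX.
have -> : #|P|%:Z - n%:Z - 1 = #|tree P|%:Z - n%:Z by rewrite -(card_tree P hP e e0); lia.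
rewrite expfzDr// -exprnP -exprnN mulrC mulrA; congr (_ * _).
Qed.

Lemma weight_ge0 e N : 0 <= weight e N.
Proof. by rewrite /weight mulr_ge0// exprz_ge0. Qed.

Lemma weight_le1 e N : (0 < N)%N -> weight e N <= 1.
Proof.
move=> N0; have [e0|/eqP/weight_neq0 ->] := \sum_(B in P) e B =P 0; last by [].
rewrite weight_density// /box_density ler_pdivrMr ?exprn_gt0 ?ltr0n// mul1r -natrX ler_nat.
by apply: leq_trans (max_card _) _; rewrite card_ffun !card_ord.
Qed.

(** Multi-indices are grouped by their block values; by hypothesis, values outside [-L, L]
    contribute nothing. *)
Lemma real_K_expand F N L :
  (forall B (i : {ffun 'I_n -> 'I_N}), B \in P -> (L < `|E_blk B i|)%N -> F (E_blk B i) = 0) ->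
  real_K F N = \sum_(e : {ffun 'I_#|P| -> 'I_L.*2.+1} | \sum_b ((e b)%:Z - L%:Z) == 0)
    weight (offset L e) N * \prod_b F ((e b)%:Z - L%:Z).
Proof.
move=> FL; transitivity (\sum_(e : {ffun 'I_#|P| -> 'I_L.*2.+1})
    weight (offset L e) N * \prod_b F ((e b)%:Z - L%:Z)); last first.
  rewrite [RHS]big_mkcond; apply: eq_bigr => e _; case: ifPn => // e0.
  by rewrite weight_neq0 ?mul0r// sum_offset.
rewrite /real_K.
rewrite (eq_bigr (fun i => \sum_(e : {ffun 'I_#|P| -> 'I_L.*2.+1})
   (i \in solutions P (offset L e) N)%:R * \prod_b F ((e b)%:Z - L%:Z))); last first.
  move=> i _; rewrite big_enum_val /=.
  (* Each factor becomes a sum over its possible values, so distributing the product yields a sum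
     over tuples [e]. *)
  rewrite (eq_bigr (fun b => \sum_(j < L.*2.+1) if j%:Z - L%:Z == E_blk (enum_val b) i
     then F (j%:Z - L%:Z) else 0)); last first.
    move=> b _; have := box_sum_delta F (E_blk (enum_val b) i) L; rewrite /box_sum => ->.
    by case: ifPn => // h; rewrite FL ?enum_valP// ltnNge.
  rewrite bigA_distr_bigA /=; apply: eq_bigr => e _.
  have [iS|iS] := boolP (i \in _).
    rewrite mul1r; apply: eq_bigr => b _; rewrite ifT// eq_sym.
    by move: iS; rewrite inE => /forallP/(_ (enum_val b)); rewrite enum_valP offsetE.
  rewrite mul0r; move: iS; rewrite inE => /forallPn[B]; rewrite negb_imply => /andP[BP].
  rewrite -(enum_rankK_in BP BP) offsetE => EB.
  by rewrite (bigD1 (enum_rank_in BP B))//= ifN ?mul0r// eq_sym.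
rewrite exchange_big mulr_sumr; apply: eq_bigr => e _.
rewrite -mulr_suml mulrA; congr (_ * _ * _).
rewrite -sum1_card natr_sum [RHS]big_mkcond; apply: eq_bigr => i _.
by case: (_ \in _).
Qed.

Context (l : R) (wl : forall e, \sum_(B in P) e B = 0 -> weight e @ \oo --> l).

Lemma real_K_truncate_cvg F M :
  real_K (truncate F M) @ \oo --> l * conv_pow F M #|P| 0.
Proof.
have -> : real_K (truncate F M) = fun N =>
   \sum_(e : {ffun 'I_#|P| -> 'I_M.*2.+1} | \sum_b ((e b)%:Z - M%:Z) == 0)
    weight (offset M e) N * \prod_b truncate F M ((e b)%:Z - M%:Z).
  apply/funext => N; apply: real_K_expand => B i _ h.
  by rewrite /truncate ifN// -ltnNge.
rewrite -(conv_pow_trunc F M M _ _ (leqnn M)) -/(truncate F M) conv_powE mulr_sumr.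
apply: cvg_big => [|e /eqP e0]; first exact: add_continuous.
apply: cvgM; last exact: cvg_cst.
by apply: wl; rewrite sum_offset.
Qed.

(** For fixed [N] the block values are bounded by some [L], so both terms are finite sums over the
    window [L]; the weights lie in [0, 1], so the tail is at most its unweighted version. *)
Lemma real_K_tail F N M : (0 < N)%N -> (forall j, 0 <= F j) ->
  exists2 L, (M <= L)%N & 0 <= real_K F N - real_K (truncate F M) N <=
    conv_pow F L #|P| 0 - conv_pow F M #|P| 0.
Proof.
move=> N0 F0.
pose L := maxn M (\max_(u : {ffun 'I_n -> 'I_N} * {set 'I_n}) `|E_blk u.2 u.1|%N).
have EL B (i : {ffun 'I_n -> 'I_N}) : (`|E_blk B i| <= L)%N.
  apply: leq_trans (leq_maxr _ _).
  exact: (leq_bigmax (i, B) (F := fun u : _ * {set 'I_n} => `|E_blk u.2 u.1|%N)).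
exists L; first exact: leq_maxl.
rewrite -(conv_pow_trunc F M L _ _ (leq_maxl _ _)) -/(truncate F M) !conv_powE.
rewrite !(real_K_expand _ N L); try by move=> B i _; rewrite ltnNge EL.
have tF j : 0 <= truncate F M j <= F j.
  by rewrite /truncate; case: ifP; rewrite ?lexx ?F0.
rewrite -!sumrB; apply/andP; split.
  apply: sumr_ge0 => e _; rewrite -mulrBr mulr_ge0 ?weight_ge0// subr_ge0.
  by apply: ler_prod => b _; exact: tF.
apply: ler_sum => e _; rewrite -mulrBr ler_piMl ?weight_le1// subr_ge0.
by apply: ler_prod => b _; exact: tF.
Qed.

(** Dominated convergence over the tuples of block values: the weights tend to [l] and are at most
    1, and the products of [F] have total sum [S]. *)
Lemma real_K_cvg F S : (forall j, 0 <= F j) -> 0 <= l ->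
  (forall M, conv_pow F M #|P| 0 <= S) ->
  (fun M => conv_pow F M #|P| 0) @ \oo --> S ->
  real_K F @ \oo --> l * S.
Proof.
move=> F0 l0 leS cS; apply/cvgrPdist_lt => e e0.
(* The factor [1 + l] covers the tail of [real_K], at most [S - SM], and that of the limit,
   [l * (S - SM)]. *)
have e1 : 0 < e / (2 * (1 + l)) by rewrite divr_gt0// mulr_gt0//; lra.
have /cvgrPdist_lt /(_ _ e1) [M _ /(_ M)] := cS; move=> /(_ (leqnn M)).
set SM := conv_pow F M _ _; rewrite ger0_norm ?subr_ge0 ?leS// => hM.
have {}hM : (S - SM) * (1 + l) < e / 2.
  move: hM; rewrite ltr_pdivlMr; last by lra.
  lra.
have e2 : 0 < e / 2 by lra.
have /cvgrPdist_lt /(_ _ e2) [N0 _ hN0] := real_K_truncate_cvg F M.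
exists (maxn 1 N0) => // N /=; rewrite geq_max => /andP[N1 /hN0 /=].
have [L ML /andP[]] := real_K_tail F N M N1 F0.
have := leS L; rewrite -/SM.
move: (real_K F N) (real_K (truncate F M) N) (conv_pow F L _ _) => k k' SL h1 h2 h3.
rewrite !ltr_norml => /andP[h4 h5].
have h6 : 0 <= S - SM by rewrite subr_ge0 leS.
apply/andP; split; nra.
Qed.

End Assembly.

(** * From the hypotheses on the density to the expansion coefficients *)

Section Final.
Context {R : realType}.
Lemma density_all_moments (p : R -> R) : in_calL p -> all_moments p.
Proof.
move=> [mp hp]; split=> // -[|k].
  by under [fun x => _]eq_fun do rewrite expr0; apply: all_moments_integrable; exact: all_moments_cst.
have k1 : 1 <= k.+1%:R :> R by rewrite ler1n.
apply/integrableP; split.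
  by apply/measurable_EFinP; apply: measurable_funX; exact: measurableT_comp.
apply: le_lt_trans (hp _ k1); rewrite le_eqVlt; apply/orP; left; apply/eqP.
apply: eq_integral => x _ /=.
by rewrite powR_mulrn// ger0_norm// exprn_ge0.
Qed.

(** In [R[i]] the relation [0 <= z] forces the imaginary part of [z] to vanish. *)
Lemma calA_sin0 (p : R -> R) : in_calA p ->
  forall k : int, intpi (fun x => sin (k%:~R * x) * p x) = 0.
Proof.
by move=> h k; have := h k; rewrite /fourier_coef lecE /= oppr_eq0 => /andP[/eqP].
Qed.

Lemma calA_cos_ge0 (p : R -> R) : in_calA p -> forall k, 0 <= cos_coef p k.
Proof. by move=> h k; have := h k; rewrite /fourier_coef lecE /= => /andP[]. Qed.

Lemma a_nu_real (p : R -> R) :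
  (forall k : int, intpi (fun x => sin (k%:~R * x) * p x) = 0) ->
  forall k, a_nu p k = (cos_coef p k)%:C%C.
Proof. by move=> s0 k; rewrite /a_nu s0. Qed.

Lemma K_N_real m (P : {set {set 'I_m.+1}}) (p : R -> R) F N :
  (forall k, a_nu p k = (F k)%:C%C) -> K_N p P N = (real_K P F N)%:C%C.
Proof.
move=> aF; rewrite /K_N /real_K rmorphM /= rmorph_sum /=; congr (_ * _).
  by rewrite fmorphXz /= rmorph_nat.
apply: eq_bigr => i _; rewrite rmorph_prod; apply: eq_bigr => B _; exact: aF.
Qed.

(** Writing the Kronecker delta as the constant 1 truncated to [|k| <= 0] makes
    [real_K_truncate_cvg] apply to the uniform law. *)
Lemma a_nu_unif (k : int) : a_nu (@unif_density R) k = (truncate (fun=> 1) 0 k : R)%:C%C.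
Proof.
have pi0 := @pi_gt0 R.
rewrite /a_nu /unif_density /truncate leqn0 absz_eq0.
have -> : intpi (fun x : R => sin (k%:~R * x) * (2 * pi)^-1) = 0.
  rewrite (@eq_intpi _ _ (fun x => (2 * pi)^-1 * cos (k%:~R * x + - (pi / 2)))); last first.
    by move=> x _; rewrite cosBpihalf mulrC.
  rewrite intpiZ ?intpi_cos; last exact: all_moments_cos.
  by rewrite cosN cos_pihalf mulr0; case: ifP; rewrite mulr0.
have -> : intpi (fun x : R => cos (k%:~R * x) * (2 * pi)^-1) = if k == 0 then 1 else 0.
  rewrite (@eq_intpi _ _ (fun x => (2 * pi)^-1 * cos (k%:~R * x + 0))); last first.
    by move=> x _; rewrite addr0 mulrC.
  rewrite intpiZ ?intpi_cos; last exact: all_moments_cos.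
  by rewrite cos0 mulr1; case: ifP; rewrite ?mulr0// mulVf//; lra.
by [].
Qed.

Lemma conv_pow_one k : conv_pow (fun=> 1) 0 k 0 = 1 :> R.
Proof. by elim: k => [//|k IH] /=; rewrite box_sum0 mul1r subr0. Qed.

Lemma cvgC_real (u : nat -> R) (l : R) : u @ \oo --> l -> cvgC (fun N => (u N)%:C%C) l%:C%C.
Proof. by move=> ul; split=> //=; exact: cvg_cst. Qed.

End Final.

Theorem theorem1 (R : realType) (p : R -> R) (n : nat) (P : {set {set 'I_n}}) :
  is_density p -> in_calL p -> in_calA p ->
  (0 < n)%N -> finset.partition P [set: 'I_n] ->
  exists Ku : R[i],
    cvgC (K_N (@unif_density R) P) Ku /\
    cvgC (K_N p P)
      (Ku * ((2 * pi) ^+ (#|P|.-1) * intpi (fun x => p x ^+ #|P|))%:C%C).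
Proof.
move=> [_ [p0 _]] /density_all_moments Lp pA.
have s0 := calA_sin0 _ pA; have a0 := calA_cos_ge0 _ pA.
case: n P => // m P _ hP; have pi0 := @pi_gt0 R.
have [l hl] := @box_density_cvg R m.+1 isT (tree P) (tree_form P)
   (fun t _ => tree_form_neq0 P hP t).
have wl e : \sum_(B in P) e B = 0 -> @weight R _ P e @ \oo --> l.
  move=> e0; apply: cvg_trans (hl (tree_shift P e)).
  apply: near_eq_cvg; exists 1%N => // N /= N0.
  by rewrite weight_density.
(* The homogeneous system serves to show that [l >= 0] and that [P] has a block. *)
have z0 : \sum_(B in P) (fun=> 0 : int) B = 0 by rewrite big1.
have l0 : 0 <= l.
  have cw := wl (fun=> 0) z0.
  rewrite -(cvg_lim (@Rhausdorff R) cw); apply: limr_ge.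
    by apply/cvg_ex; exists l.
  by apply: nearW => N; exact: weight_ge0.
have P0 : (0 < #|P|)%N by rewrite -(card_tree P hP (fun=> 0) z0).
set S := (2 * pi) ^+ #|P|.-1 * _.
(* The Fourier coefficient of [p ^ r] at 0 is its integral; one factor [2 * pi] is split off to
   match the left-hand side of [conv_pow_cvg]. *)
have SE : (2 * pi) ^+ #|P| * cos_coef (fun x => p x ^+ #|P|) 0 = 2 * pi * S.
  rewrite -{1}(prednK P0) exprS -mulrA /S; congr (_ * (_ * _)).
  by apply: eq_intpi => x _; rewrite mul0r cos0 mul1r.
(* The limit [l] of the weights does not involve the measure. For the uniform law it is multiplied
   by the convolution power of the delta, equal to 1. *)
exists l%:C%C; split.
  rewrite (_ : K_N _ _ = fun N => (real_K P (truncate (fun=> 1) 0) N)%:C%C); last first.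
    by apply/funext => N; exact/K_N_real/a_nu_unif.
  apply: cvgC_real; rewrite -[X in _ --> X]mulr1 -[X in l * X](conv_pow_one #|P|).
  exact: real_K_truncate_cvg.
rewrite -rmorphM /= (_ : K_N _ _ = fun N => (real_K P (cos_coef p) N)%:C%C); last first.
  by apply/funext => N; exact/K_N_real/a_nu_real.
apply: cvgC_real; apply: real_K_cvg => //.
  move=> M; rewrite -(@ler_pM2l _ (2 * pi)) ?mulr_gt0// -SE.
  exact: conv_pow_le.
have := conv_pow_cvg Lp s0 p0 a0 #|P| 0; rewrite SE => h.
have pi2 : (2 * pi : R) != 0 by rewrite mulf_neq0// gt_eqF.
have -> : (fun M => conv_pow (cos_coef p) M #|P| 0) =
    fun M => (2 * pi)^-1 * (2 * pi * conv_pow (cos_coef p) M #|P| 0).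
  by apply/funext => M; rewrite mulKf.
have E : S = (2 * pi)^-1 * (2 * pi * S) by rewrite mulKf.
rewrite [X in _ --> X]E.
by apply: cvgM => //; exact: cvg_cst.
Qed.
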